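(* Let $H$ be a colour Hopf algebra and $A$ a graded $H$-comodule colour algebra. Set $B=A^{coH}$. Assume that there is a graded $H$-colinear map $\theta:H\to A$ which is a homomorphism of colour algebras. Then: (1) the adjoint pair $(F,G)$ between ${}_{\mathrm{gr}\text{-}B}\mathcal M$ and ${}_{\mathrm{gr}\text{-}A}^{\mathrm{gr}\text{-}H}\mathcal M$, where $F=A\otimes_B-$ and $G=(-)^{coH}$, with unit $\eta_N:N\to(A\otimes_BN)^{coH}$, $n\mapsto 1_A\otimes_B n$, and counit $\alpha_M:A\otimes_BM^{coH}\to M$, $a\otimes_B m\mapsto am$, is a pair of inverse equivalences; (2) $A$ is faithfully flat as a graded right $B$-module; (3) $A$ is a graded Hopf-Galois extension of $B$.
   Context: $\Bbbk$ is a field and $G$ is a multiplicative abelian group (the grading group; not to be confused with the functor $G$) with identity $e$ and a bicharacter $(\cdot/\cdot):G\times G\to\Bbbk^{\times}$, i.e. $(g/g'g'')=(g/g')(g/g'')$ and $(gg'/g'')=(g/g'')(g'/g'')$. ''Graded'' means $G$-graded; $|m|$ is the degree of a homogeneous element $m$; formulas are written for homogeneous elements and extended linearly. A graded map $f:M\to N$ is a $\Bbbk$-linear map with $f(M_g)\subseteq N_g$ for all $g$. $\otimes=\otimes_{\Bbbk}$, graded by $(M\otimes N)_g=\bigoplus_{g'g''=g}M_{g'}\otimes N_{g''}$; $\Bbbk$ is in degree $e$. A colour algebra is a $G$-graded associative unital $\Bbbk$-algebra; a homomorphism of colour algebras is a graded map that is a unital $\Bbbk$-algebra homomorphism. A colour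 Hopf algebra $H$ is a colour algebra which is also a (coassociative, counital) coalgebra with graded maps $\Delta_H$, $\varepsilon_H$ (write $\Delta_H(h)=h_1\otimes h_2$ with homogeneous components), such that $\varepsilon_H$ is a unital algebra map, $\Delta_H(1_H)=1_H\otimes 1_H$, $\Delta_H(hh')=(|h_2|/|h'_1|)\,h_1h'_1\otimes h_2h'_2$, and with a graded map $\mathcal S_H:H\to H$ (antipode) satisfying $h_1\mathcal S_H(h_2)=\varepsilon_H(h)1_H=\mathcal S_H(h_1)h_2$. A graded $H$-comodule is a graded vector space $M$ with a graded map $\chi_M:M\to H\otimes M$, $\chi_M(m)=m_{(-1)}\otimes m_{(0)}$, which is coassociative and counital (left comodule). $H$ is a graded $H$-comodule via $\Delta_H$. A graded $H$-colinear map is a graded map $f$ with $f(m)_{(-1)}\otimes f(m)_{(0)}=m_{(-1)}\otimes f(m_{(0)})$. Coinvariants: $M^{coH}=\{m\in M:\chi_M(m)=1_H\otimes m\}$, a graded subspace. A graded $H$-comodule colour algebra is a colour algebra $A$ that is a graded $H$-comodule with $\chi_A(1_A)=1_H\otimes 1_A$ and $\chi_A(aa')=(|a_{(0)}|/|a'_{(-1)}|)\,a_{(-1)}a'_{(-1)}\otimes a_{(0)}a'_{(0)}$. For a colour algebra $R$, ${}_{\mathrm{gr}\text{-}R}\mathcal M$ is the category of graded left $R$-modules ($R_gM_{g'}\subseteq M_{gg'}$) with graded $R$-linear maps. A colour $(A,H)$-Hopf module is a graded left $A$-module and graded $H$-comodule $M$ (same grading) with $\chi_M(am)=(|a_{(0)}|/|m_{(-1)}|)\,a_{(-1)}m_{(-1)}\otimes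 a_{(0)}m_{(0)}$; ${}_{\mathrm{gr}\text{-}A}^{\mathrm{gr}\text{-}H}\mathcal M$ is the category of these, with graded $A$-linear graded $H$-colinear maps. $B=A^{coH}$ is a graded subalgebra of $A$ and $M^{coH}$ is a graded left $B$-module. For a graded left $B$-module $N$, $A\otimes_B N$ is a colour $(A,H)$-Hopf module via $a(a'\otimes_B n)=(aa')\otimes_B n$ and $\chi(a\otimes_B n)=a_{(-1)}\otimes a_{(0)}\otimes_B n$. $A$ is faithfully flat as a graded right $B$-module if a sequence $0\to N\to N'\to N''\to0$ in ${}_{\mathrm{gr}\text{-}B}\mathcal M$ is exact if and only if $0\to A\otimes_BN\to A\otimes_BN'\to A\otimes_BN''\to0$ is exact. $A$ is a graded Hopf-Galois extension of $B$ if the graded $\Bbbk$-linear map $can:A\otimes_BA\to H\otimes A$, $a\otimes_Ba'\mapsto a_{(-1)}\otimes(a_{(0)}a')$, is an isomorphism of colour $(A,H)$-Hopf modules, where $A\otimes_BA$ has action $a(a'\otimes_Ba'')=(aa')\otimes_Ba''$ and coaction $a\otimes_Ba'\mapsto a_{(-1)}\otimes a_{(0)}\otimes_Ba'$, and $H\otimes A$ has coaction $\Delta_H\otimes id_A$ and action $a(h\otimes a')=(|a_{(0)}|/|h|)(a_{(-1)}h)\otimes(a_{(0)}a')$. *)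

(* Defs.v *)
From HB Require Import structures.
From mathcomp Require Import all_boot all_order all_algebra.
From mathcomp Require Import boolp.

Set Implicit Arguments.
Unset Strict Implicit.
Unset Printing Implicit Defensive.

Import GRing.Theory.
Local Open Scope ring_scope.
Local Open Scope quotient_scope.

Section LinearProp.
Variables (k : fieldType).
Implicit Types U V W : lmodType k.

Lemma lin0 V W (f : V -> W) : linear f -> f 0 = 0.
Proof. by move=> fl; have := fl (-1) 0 0; rewrite scaler0 addr0 scaleN1r addNr. Qed.

Lemma linD V W (f : V -> W) : linear f -> forall u v, f (u + v) = f u + f v.
Proof. by move=> fl u v; have := fl 1 u v; rewrite !scale1r. Qed.

Lemma linZ V W (f : V -> W) : linear f -> forall a v, f (a *: v) = a *: f v.
Proof. by move=> fl a v; have := fl a v 0; rewrite !addr0 (lin0 fl) addr0. Qed.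

Lemma lin_sum V W (f : V -> W) : linear f ->
  forall (I : Type) (s : seq I) (F : I -> V),
  f (\sum_(i <- s) F i) = \sum_(i <- s) f (F i).
Proof.
move=> fl I s F; elim: s => [|i s IH]; first by rewrite !big_nil lin0.
by rewrite !big_cons linD // IH.
Qed.

Lemma lin_id V : linear (fun v : V => v).
Proof. by []. Qed.

Lemma lin_comp U V W (f : V -> W) (g : U -> V) :
  linear f -> linear g -> linear (fun u => f (g u)).
Proof. by move=> fl gl a u v; rewrite gl fl. Qed.

Lemma lin_scale V W (f : V -> W) b : linear f -> linear (fun v => b *: f v).
Proof. by move=> fl a u v; rewrite fl scalerDr !scalerA mulrC. Qed.

Lemma lin_sumf V W (I : Type) (s : seq I) (F : I -> V -> W) :
  (forall i, linear (F i)) -> linear (fun v => \sum_(i <- s) F i v).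
Proof.
move=> Fl a u v; rewrite scaler_sumr -big_split /=.
by apply: eq_bigr => i _; rewrite Fl.
Qed.

Definition bilin U V W (f : U -> V -> W) : Prop :=
  (forall v, linear (f^~ v)) /\ (forall u, linear (f u)).

End LinearProp.

(* M (x)_S N for a right action ra of S on M and a left action la of S on N:
   formal sums of symbols m (x) n, modulo the least k-linear congruence making
   (x) bilinear and S-balanced. A list [:: (m1, n1); ...; (mr, nr)] stands for
   the formal sum of the mi (x) ni. *)
Section BalancedTensor.
Variables (k : fieldType) (M N : lmodType k) (S : Type).
Variables (ra : M -> S -> M) (la : S -> N -> N).

Definition fscale (a : k) (s : seq (M * N)) := [seq (a *: p.1, p.2) | p <- s].

Inductive tens_rel : seq (M * N) -> seq (M * N) -> Prop :=
| tens_refl s : tens_rel s s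
| tens_sym s t : tens_rel s t -> tens_rel t s
| tens_trans s t u : tens_rel s t -> tens_rel t u -> tens_rel s u
| tens_cat s s' t t' :
    tens_rel s s' -> tens_rel t t' -> tens_rel (s ++ t) (s' ++ t')
| tens_catC s t : tens_rel (s ++ t) (t ++ s)
| tens_fscale a s t : tens_rel s t -> tens_rel (fscale a s) (fscale a t)
| tens_0 n : tens_rel [:: (0, n)] [::]
| tens_Dl m m' n : tens_rel [:: (m + m', n)] [:: (m, n); (m', n)]
| tens_Dr m n n' : tens_rel [:: (m, n + n')] [:: (m, n); (m, n')]
| tens_Z a m n : tens_rel [:: (a *: m, n)] [:: (m, a *: n)]
| tens_bal m b n : tens_rel [:: (ra m b, n)] [:: (m, la b n)].

Definition tens_relb (s t : seq (M * N)) : bool := `[< tens_rel s t >].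

Lemma tens_relb_equiv : equiv_class_of tens_relb.
Proof.
split=> [s|s t|t s u].
- by apply/asboolP; apply: tens_refl.
- by apply/asboolP/asboolP; apply: tens_sym.
- by move=> /asboolP st /asboolP tu; apply/asboolP; apply: tens_trans st tu.
Qed.

Canonical tens_equiv := EquivRelPack tens_relb_equiv.

Definition btens := {eq_quot tens_equiv}.
HB.instance Definition _ := Choice.on btens.
HB.instance Definition _ := EqQuotient.on btens.

Definition fsum (s : seq (M * N)) : btens := \pi_btens s.

Lemma fsum_eqP (s t : seq (M * N)) : fsum s = fsum t <-> tens_rel s t.
Proof.
split=> [/eqP|st]; first by rewrite eqmodE => /asboolP.
by apply/eqP; rewrite eqmodE; apply/asboolP.
Qed.

Lemma fsum_repr (x : btens) : fsum (repr x) = x.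
Proof. exact: reprK. Qed.

Lemma repr_fsum (s : seq (M * N)) : tens_rel (repr (fsum s)) s.
Proof. by apply/fsum_eqP; rewrite fsum_repr. Qed.

Definition bt_add (x y : btens) := fsum (repr x ++ repr y).
Definition bt_scale (a : k) (x : btens) := fsum (fscale a (repr x)).
Definition bt_zero := fsum [::].
Definition bt_opp (x : btens) := bt_scale (-1) x.

Lemma fsum_cat s t : fsum (s ++ t) = bt_add (fsum s) (fsum t).
Proof. by apply/fsum_eqP/tens_cat; apply/tens_sym/repr_fsum. Qed.

Lemma fsum_fscale a s : fsum (fscale a s) = bt_scale a (fsum s).
Proof. by apply/fsum_eqP/tens_fscale/tens_sym/repr_fsum. Qed.

Lemma fsum_ind (P : btens -> Prop) : (forall s, P (fsum s)) -> forall x, P x.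
Proof. by move=> Ps x; rewrite -(fsum_repr x). Qed.

Lemma bt_addA : associative bt_add.
Proof.
elim/fsum_ind=> s; elim/fsum_ind=> t; elim/fsum_ind=> u.
by rewrite -!fsum_cat catA.
Qed.

Lemma bt_addC : commutative bt_add.
Proof.
elim/fsum_ind=> s; elim/fsum_ind=> t; rewrite -!fsum_cat.
exact/fsum_eqP/tens_catC.
Qed.

Lemma bt_add0 : left_id bt_zero bt_add.
Proof. by elim/fsum_ind=> s; rewrite -fsum_cat. Qed.

Lemma bt_scaleDl x a b : bt_scale (a + b) x = bt_add (bt_scale a x) (bt_scale b x).
Proof.
elim/fsum_ind: x => s; rewrite -!fsum_fscale -fsum_cat; apply/fsum_eqP.
elim: s => [|[m n] s IH]; first exact: tens_refl.
have -> : fscale a ((m, n) :: s) ++ fscale b ((m, n) :: s) =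
    [:: (a *: m, n)] ++ ((fscale a s ++ [:: (b *: m, n)]) ++ fscale b s).
  by rewrite /= -catA.
have -> : fscale (a + b) ((m, n) :: s) = [:: ((a + b) *: m, n)] ++ fscale (a + b) s.
  by [].
apply: tens_trans (_ : tens_rel _
    ([:: (a *: m, n); (b *: m, n)] ++ (fscale a s ++ fscale b s))) _.
  by apply: tens_cat IH; rewrite scalerDl; apply: tens_Dl.
rewrite -[[:: _; _]]/([:: (a *: m, n)] ++ [:: (b *: m, n)]) -catA.
apply: tens_cat; first exact: tens_refl.
rewrite catA; apply: tens_cat; last exact: tens_refl.
exact: tens_catC.
Qed.

Lemma bt_scale0 x : bt_scale 0 x = bt_zero.
Proof.
elim/fsum_ind: x => s; rewrite -fsum_fscale; apply/fsum_eqP.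
elim: s => [|[m n] s IH] /=; first exact: tens_refl.
by rewrite scale0r -cat1s -[[::]]/([::] ++ [::]); apply: tens_cat IH; apply: tens_0.
Qed.

Lemma bt_scale1 x : bt_scale 1 x = x.
Proof.
elim/fsum_ind: x => s; rewrite -fsum_fscale; congr fsum.
by elim: s => [|[m n] s IH] //=; rewrite scale1r IH.
Qed.

Lemma bt_addN : left_inverse bt_zero bt_opp bt_add.
Proof.
by move=> x; rewrite -{2}(bt_scale1 x) -bt_scaleDl addNr bt_scale0.
Qed.

HB.instance Definition _ :=
  GRing.isZmodule.Build btens bt_addA bt_addC bt_add0 bt_addN.

Lemma bt_scaleA a b x : bt_scale a (bt_scale b x) = bt_scale (a * b) x.
Proof.
elim/fsum_ind: x => s; rewrite -!fsum_fscale; congr fsum.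
by rewrite /fscale -map_comp; apply: eq_map => p /=; rewrite scalerA.
Qed.

Lemma fsumD s t : fsum (s ++ t) = fsum s + fsum t.
Proof. exact: fsum_cat. Qed.

Lemma bt_scaleDr : right_distributive bt_scale +%R.
Proof.
move=> a; elim/fsum_ind=> s; elim/fsum_ind=> t.
rewrite -fsumD -!fsum_fscale -fsumD; congr fsum.
by rewrite /fscale map_cat.
Qed.

HB.instance Definition _ := GRing.Zmodule_isLmodule.Build k btens
  bt_scaleA bt_scale1 bt_scaleDr (fun v a b => bt_scaleDl v a b).

Lemma fsumZ a s : fsum (fscale a s) = a *: fsum s.
Proof. exact: fsum_fscale. Qed.

Definition bpure (m : M) (n : N) : btens := fsum [:: (m, n)].

Lemma bpure_linl n : linear (bpure^~ n).
Proof.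
move=> a m m'; rewrite /bpure -fsumZ -fsumD; exact/fsum_eqP/tens_Dl.
Qed.

Lemma bpure_linr m : linear (bpure m).
Proof.
move=> a n n'; rewrite /bpure -fsumZ -fsumD.
apply/fsum_eqP/(tens_trans (tens_Dr _ _ _)).
rewrite -cat1s -[X in _ ++ X]cat1s cats0; apply: tens_cat; last exact: tens_refl.
exact/tens_sym/tens_Z.
Qed.

Lemma bpure_bal m b n : bpure (ra m b) n = bpure m (la b n).
Proof. exact/fsum_eqP/tens_bal. Qed.

Lemma bpure_sum (s : seq (M * N)) : fsum s = \sum_(p <- s) bpure p.1 p.2.
Proof.
elim: s => [|[m n] s IH]; first by rewrite big_nil.
by rewrite big_cons -cat1s fsumD IH.
Qed.

Lemma btens_sum (x : btens) : x = \sum_(p <- repr x) bpure p.1 p.2.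
Proof. by rewrite -bpure_sum fsum_repr. Qed.

Lemma btens_ext (W : lmodType k) (f g : btens -> W) : linear f -> linear g ->
  (forall m n, f (bpure m n) = g (bpure m n)) -> f =1 g.
Proof.
move=> fl gl fg x; rewrite (btens_sum x) !lin_sum //.
by apply: eq_bigr => p _; apply: fg.
Qed.

Definition balanced (W : lmodType k) (f : M -> N -> W) : Prop :=
  bilin f /\ (forall m b n, f (ra m b) n = f m (la b n)).

(* The linear map out of the tensor product determined by f; only meaningful
   for balanced f (blift_pure). *)
Definition blift (W : lmodType k) (f : M -> N -> W) (x : btens) : W :=
  \sum_(p <- repr x) f p.1 p.2.

Section Lift.
Variables (W : lmodType k) (f : M -> N -> W) (fb : balanced f).

Lemma tens_rel_sum s t : tens_rel s t ->
  \sum_(p <- s) f p.1 p.2 = \sum_(p <- t) f p.1 p.2.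
Proof.
case: fb => [[fl fr] fbal].
elim=> {s t} [s|s t _ ->|s t u _ -> _ ->|s s' t t' _ IH1 _ IH2|s t|a s t _ IH|n
             |m m' n|m n n'|a m n|m b n] //=; rewrite ?big_cons ?big_nil ?addr0 /=.
- by rewrite !big_cat IH1 IH2.
- by rewrite !big_cat /= addrC.
- rewrite /fscale !big_map /=.
  have E u : \sum_(p <- u) f (a *: p.1) p.2 = a *: \sum_(p <- u) f p.1 p.2.
    by rewrite scaler_sumr; apply: eq_bigr => p _; rewrite (linZ (fl p.2)).
  by rewrite !E IH.
- exact: (lin0 (fl n)).
- exact: (linD (fl n)).
- exact: (linD (fr m)).
- by rewrite (linZ (fl n)) (linZ (fr m)).
- exact: fbal.
Qed.

Lemma blift_fsum s : blift f (fsum s) = \sum_(p <- s) f p.1 p.2.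
Proof. exact/tens_rel_sum/repr_fsum. Qed.

Lemma blift_pure m n : blift f (bpure m n) = f m n.
Proof. by rewrite blift_fsum big_cons big_nil addr0. Qed.

Lemma blift_lin : linear (blift f).
Proof.
case: fb => [[fl fr] fbal].
move=> a; elim/fsum_ind=> s; elim/fsum_ind=> t.
rewrite -fsumZ -fsumD !blift_fsum big_cat; congr (_ + _).
rewrite big_map scaler_sumr; apply: eq_bigr => p _ /=.
by rewrite (linZ (fl p.2)).
Qed.

End Lift.

Lemma blift_linf (U W : lmodType k) (f : U -> M -> N -> W) (x : btens) :
  (forall m n, linear (fun u => f u m n)) -> linear (fun u => blift (f u) x).
Proof. by move=> fl; apply: lin_sumf => p. Qed.

Lemma eq_blift (W : lmodType k) (f g : M -> N -> W) :
  (forall m n, f m n = g m n) -> blift f =1 blift g.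
Proof. by move=> fg x; apply: eq_bigr => p _; apply: fg. Qed.

End BalancedTensor.

Section Grading.
Variables (k : fieldType) (G : zmodType).

(* A decomposition V = (+)_g V_g, given by the family of its projections
   gpr g : V -> V_g, so that V_g is the range {v | gpr g v = v} of gpr g. *)
Record grading (V : lmodType k) := Grading {
  gpr : G -> V -> V;
  gpr_lin : forall g, linear (gpr g);
  gprK : forall g h v, gpr g (gpr h v) = if g == h then gpr h v else 0;
  gpr_sum : forall v, exists2 s : seq G, uniq s & v = \sum_(g <- s) gpr g v
}.

Record gvect := GVect {
  gv_car :> lmodType k;
  gv_gr : grading gv_car
}.

Definition gc (V : gvect) (g : G) (v : V) : V := gpr (gv_gr V) g v.

Definition homog (V : gvect) (g : G) (v : V) : Prop := gc g v = v.

Definition graded (V W : gvect) (f : V -> W) : Prop :=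
  forall g v, homog g v -> homog g (f v).

Lemma grading_sum_gen (V : lmodType k) (p : G -> V -> V) :
  (forall g, linear (p g)) ->
  (forall g h v, p g (p h v) = if g == h then p h v else 0) ->
  forall (t : seq (G * V)) (v : V), v = \sum_(q <- t) q.2 ->
  (forall q, q \in t -> p q.1 q.2 = q.2) ->
  exists2 s : seq G, uniq s & v = \sum_(g <- s) p g v.
Proof.
move=> pl pK t v vE tp; exists (undup [seq q.1 | q <- t]); first exact: undup_uniq.
rewrite {2}vE; under eq_bigr => g _ do rewrite (lin_sum (pl g)).
rewrite exchange_big /= {1}vE; apply: eq_big_seq => q qt.
rewrite (bigD1_seq q.1) ?undup_uniq ?mem_undup ?map_f //= tp //.
rewrite big1 ?addr0 // => g /negPf gq.
by rewrite -(tp _ qt) pK gq.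
Qed.

Section GradedSpace.
Variable V : gvect.
Implicit Types (g h : G) (v : V).

Lemma gc_lin g : linear (@gc V g). Proof. exact: gpr_lin. Qed.
Lemma gcK g h v : gc g (gc h v) = if g == h then gc h v else 0.
Proof. exact: gprK. Qed.
Lemma gc_sum v : exists2 s : seq G, uniq s & v = \sum_(g <- s) gc g v.
Proof. exact: gpr_sum. Qed.

Lemma homog_gc g v : homog g (gc g v).
Proof. by rewrite /homog gcK eqxx. Qed.

Lemma homog0 g : homog g (0 : V).
Proof. exact: lin0 (gc_lin g). Qed.

Lemma gc_homog g h v : homog h v -> gc g v = if g == h then v else 0.
Proof. by move=> hv; rewrite -{1}hv gcK hv. Qed.

Lemma homogZ g a v : homog g v -> homog g (a *: v).
Proof. by move=> hv; rewrite /homog (linZ (gc_lin g)) hv. Qed.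

Lemma homogD g v v' : homog g v -> homog g v' -> homog g (v + v').
Proof. by move=> hv hv'; rewrite /homog (linD (gc_lin g)) hv hv'. Qed.

Lemma homog_sum (I : Type) (s : seq I) g (F : I -> V) :
  (forall i, homog g (F i)) -> homog g (\sum_(i <- s) F i).
Proof.
move=> hF; elim: s => [|i s IH]; first by rewrite big_nil; apply: homog0.
by rewrite big_cons; apply: homogD.
Qed.

Definition gsupp v : seq G := s2val (cid2 (gc_sum v)).

Lemma gsupp_uniq v : uniq (gsupp v).
Proof. exact: (s2valP (cid2 (gc_sum v))). Qed.

Lemma gsupp_sum v : v = \sum_(g <- gsupp v) gc g v.
Proof. exact: (s2valP' (cid2 (gc_sum v))). Qed.

Lemma gc_notin v (s : seq G) g : v = \sum_(h <- s) gc h v -> g \notin s -> gc g v = 0.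
Proof.
move=> vE gs; rewrite vE (lin_sum (gc_lin g)) big1_seq // => h /andP[_ hs].
by rewrite gcK; case: eqP gs => // ->; rewrite hs.
Qed.

(* The linear extension of a formula F g v given for v of degree g. *)
Definition gext (W : lmodType k) (F : G -> V -> W) (v : V) : W :=
  \sum_(g <- gsupp v) F g (gc g v).

Lemma big_gc_eq (W : lmodType k) (F : G -> V -> W) v (s t : seq G) :
  (forall g, F g 0 = 0) -> uniq s -> uniq t -> v = \sum_(g <- s) gc g v ->
  v = \sum_(g <- t) gc g v ->
  \sum_(g <- s) F g (gc g v) = \sum_(g <- t) F g (gc g v).
Proof.
move=> F0.
suff H (s' t' : seq G) : uniq s' -> uniq t' -> v = \sum_(g <- s') gc g v ->
    {subset s' <= t'} -> \sum_(g <- s') F g (gc g v) = \sum_(g <- t') F g (gc g v).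
  move=> us ut sE tE; have uu := undup_uniq (s ++ t).
  rewrite (H s (undup (s ++ t))) // ?(H t (undup (s ++ t))) //.
    by move=> x xt; rewrite mem_undup mem_cat xt orbT.
  by move=> x xt; rewrite mem_undup mem_cat xt.
move=> us ut sE sub.
rewrite [RHS](bigID (mem s')) /= [X in _ = _ + X]big1 ?addr0; last first.
  by move=> g gs; rewrite (gc_notin sE gs) F0.
rewrite -[RHS]big_filter; apply: perm_big; apply: uniq_perm; rewrite ?filter_uniq //.
by move=> x; rewrite mem_filter; case xs: (x \in s') => //=; rewrite sub.
Qed.

Lemma gextE (W : lmodType k) (F : G -> V -> W) v (s : seq G) :
  (forall g, F g 0 = 0) -> uniq s -> v = \sum_(g <- s) gc g v ->
  gext F v = \sum_(g <- s) F g (gc g v).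
Proof. by move=> F0 us sE; apply: big_gc_eq => //; [apply: gsupp_uniq|apply: gsupp_sum]. Qed.

Lemma gc_sum_sup v (s t : seq G) : uniq s -> uniq t -> v = \sum_(g <- s) gc g v ->
  {subset s <= t} -> v = \sum_(g <- t) gc g v.
Proof.
move=> us ut sE sub; rewrite {1}sE.
rewrite [RHS](bigID (mem s)) /= [X in _ = _ + X]big1 ?addr0; last first.
  by move=> g gs; rewrite (gc_notin sE gs).
rewrite -[RHS]big_filter; apply: perm_big; apply: uniq_perm; rewrite ?filter_uniq //.
by move=> x; rewrite mem_filter; case xs: (x \in s) => //=; rewrite sub.
Qed.

Lemma gext_lin (W : lmodType k) (F : G -> V -> W) :
  (forall g, linear (F g)) -> linear (gext F).
Proof.
move=> Fl a u v.
have F0 g : F g 0 = 0 by apply: lin0.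
have uu := undup_uniq (gsupp u ++ gsupp v); set s := undup _ in uu.
have uE : u = \sum_(g <- s) gc g u.
  apply: gc_sum_sup (gsupp_uniq u) uu (gsupp_sum u) _ => x xs.
  by rewrite mem_undup mem_cat xs.
have vE : v = \sum_(g <- s) gc g v.
  apply: gc_sum_sup (gsupp_uniq v) uu (gsupp_sum v) _ => x xs.
  by rewrite mem_undup mem_cat xs orbT.
have wE : a *: u + v = \sum_(g <- s) gc g (a *: u + v).
  rewrite {1}uE {1}vE scaler_sumr -big_split /=.
  by apply: eq_bigr => g _; rewrite gc_lin.
rewrite (gextE F0 uu uE) (gextE F0 uu vE) (gextE F0 uu wE) scaler_sumr -big_split /=.
by apply: eq_bigr => g _; rewrite gc_lin Fl.
Qed.

Lemma gext_eq0 (W : lmodType k) (F : G -> V -> W) v :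
  (forall g v, F g v = 0) -> gext F v = 0.
Proof. by move=> F0; apply: big1. Qed.

Lemma gext_linf (U W : lmodType k) (F : U -> G -> V -> W) v :
  (forall g v, linear (fun u => F u g v)) -> linear (fun u => gext (F u) v).
Proof. by move=> Fl; apply: lin_sumf. Qed.

Lemma gext_homog (W : lmodType k) (F : G -> V -> W) g v :
  (forall g, F g 0 = 0) -> homog g v -> gext F v = F g v.
Proof.
move=> F0 hv; rewrite (@gextE _ F v [:: g]) ?big_cons ?big_nil ?addr0 //; by rewrite hv.
Qed.

Lemma homog_ext (W : lmodType k) (f f' : V -> W) : linear f -> linear f' ->
  (forall g v, homog g v -> f v = f' v) -> f =1 f'.
Proof.
move=> fl fl' ff v; rewrite (gsupp_sum v) !lin_sum //.
by apply: eq_bigr => g _; apply: ff (homog_gc g v).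
Qed.

End GradedSpace.

Lemma degP (V W : gvect) (f : V -> W) d : linear f ->
  (forall g v, homog g v -> homog (g + d) (f v)) <->
  (forall g v, gc (g + d) (f v) = f (gc g v)).
Proof.
move=> fl; split=> [fd g v|fd g v hv]; last by rewrite /homog fd hv.
move: v; apply: homog_ext => [||h v hv].
- exact: lin_comp (gc_lin _) fl.
- exact: lin_comp fl (gc_lin g).
- rewrite (gc_homog _ (fd _ _ hv)) (gc_homog _ hv) (inj_eq (addIr d)).
  by case: eqP; rewrite ?lin0.
Qed.

Section GradedTensor.
Variables (M N : gvect) (S : Type) (ra : M -> S -> M) (la : S -> N -> N).

Definition gt_fun (g : G) (m : M) (n : N) : btens ra la :=
  gext (fun h m' => bpure ra la m' (gc (g - h) n)) m.

Lemma gt_fun_bilin g : bilin (gt_fun g).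
Proof.
split=> [n|m].
- by apply: gext_lin => h; apply: bpure_linl.
- by apply: gext_linf => h m'; apply: lin_comp (gc_lin _); apply: bpure_linr.
Qed.

Lemma gt_fun_homog g h m n : homog h m -> gt_fun g m n = bpure ra la m (gc (g - h) n).
Proof.
by move=> hm; rewrite /gt_fun (gext_homog _ hm) // => h'; apply: lin0 (bpure_linl _ _ _).
Qed.

Hypothesis bal : forall g m b n, gt_fun g (ra m b) n = gt_fun g m (la b n).

Lemma gt_fun_bal g : balanced ra la (gt_fun g).
Proof. by split; [apply: gt_fun_bilin|apply: bal]. Qed.

Definition gt_pr (g : G) : btens ra la -> btens ra la := blift (gt_fun g).

Lemma gt_pr_lin g : linear (gt_pr g).
Proof. exact/blift_lin/gt_fun_bal. Qed.

Lemma gt_pr_pure g h l m n : homog h m -> homog l n ->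
  gt_pr g (bpure ra la m n) = if g == h + l then bpure ra la m n else 0.
Proof.
move=> hm hn; rewrite /gt_pr (blift_pure (gt_fun_bal g)) (gt_fun_homog _ _ hm).
rewrite (gc_homog _ hn) subr_eq addrC.
by case: eqP => // _; apply: lin0 (bpure_linr _ _ _).
Qed.

Lemma hpure_ext (W : lmodType k) (f f' : btens ra la -> W) : linear f -> linear f' ->
  (forall h l m n, homog h m -> homog l n -> f (bpure ra la m n) = f' (bpure ra la m n)) ->
  f =1 f'.
Proof.
move=> fl fl' ff; apply: btens_ext => // m n; move: m.
apply: homog_ext => [||h m hm].
- exact: lin_comp fl (bpure_linl _ _ n).
- exact: lin_comp fl' (bpure_linl _ _ n).
move: n; apply: homog_ext => [||l n hn]; last exact: ff hm hn.
- exact: lin_comp fl (bpure_linr _ _ m).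
- exact: lin_comp fl' (bpure_linr _ _ m).
Qed.

Lemma gt_prK g h x : gt_pr g (gt_pr h x) = if g == h then gt_pr h x else 0.
Proof.
move: x; apply: hpure_ext => [||a b m n hm hn].
- exact: lin_comp (gt_pr_lin g) (gt_pr_lin h).
- by case: eqP => _; [apply: gt_pr_lin|move=> a u v; rewrite scaler0 addr0].
rewrite (gt_pr_pure h hm hn); case: (h =P a + b) => [->|_].
  by rewrite (gt_pr_pure g hm hn).
by rewrite (lin0 (gt_pr_lin g)); case: eqP.
Qed.

Lemma gt_pr_sum x : exists2 s : seq G, uniq s & x = \sum_(g <- s) gt_pr g x.
Proof.
suff [t xE ht] : exists2 t : seq (G * btens ra la), x = \sum_(q <- t) q.2 &
    forall q, q \in t -> gt_pr q.1 q.2 = q.2.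
  exact: (grading_sum_gen gt_pr_lin gt_prK xE ht).
rewrite (btens_sum x); elim: (repr x) => [|[m n] s [t tE ht]].
  by exists [::] => //; rewrite !big_nil.
pose u := [seq (h + l, bpure ra la (gc h m) (gc l n)) | h <- gsupp m, l <- gsupp n].
exists (u ++ t); last first.
  move=> q; rewrite mem_cat => /orP[|]; last exact: ht.
  move=> /allpairsP[[h l] /= [_ _ ->]] /=.
  by rewrite (gt_pr_pure _ (homog_gc h m) (homog_gc l n)) eqxx.
rewrite big_cons big_cat tE; congr (_ + _) => /=.
rewrite big_allpairs_dep /= {1}(gsupp_sum m) (lin_sum (bpure_linl _ _ _)).
apply: eq_bigr => h _; rewrite {1}(gsupp_sum n) (lin_sum (bpure_linr _ _ _)).
by [].
Qed.

Definition gt_grading : grading (btens ra la) := Grading gt_pr_lin gt_prK gt_pr_sum.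

Definition gbtens : gvect := GVect gt_grading.

Lemma homog_bpure h l m n : homog h m -> homog l n ->
  @homog gbtens (h + l) (bpure ra la m n).
Proof. by move=> hm hn; rewrite /homog /gc /= (gt_pr_pure _ hm hn) eqxx. Qed.

Lemma gbtens_deg (W : gvect) (f : gbtens -> W) d : linear f ->
  (forall h l m n, homog h m -> homog l n -> homog (h + l + d) (f (bpure ra la m n))) ->
  forall g x, homog g x -> homog (g + d) (f x).
Proof.
move=> fl fd; apply/(degP _ fl) => g; apply: hpure_ext => [||h l m n hm hn].
- exact: lin_comp (gc_lin _) fl.
- exact: lin_comp fl (gc_lin (V:=gbtens) g).
- rewrite (gc_homog _ (fd _ _ _ _ hm hn)) (gc_homog _ (homog_bpure hm hn)).
  by rewrite (inj_eq (addIr d)); case: eqP; rewrite ?lin0.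
Qed.

Lemma gbtens_graded (W : gvect) (f : gbtens -> W) : linear f ->
  (forall h l m n, homog h m -> homog l n -> homog (h + l) (f (bpure ra la m n))) ->
  graded f.
Proof.
move=> fl fd g x hx; rewrite -[g]addr0; apply: gbtens_deg => // h l m n hm hn.
by rewrite addr0; apply: fd.
Qed.

End GradedTensor.

(* M (x)_k N is the case S = k, acting by scalars on both sides. *)
Definition scr (M : lmodType k) (m : M) (a : k) : M := a *: m.
Definition scl (M : lmodType k) (a : k) (m : M) : M := a *: m.
Notation tens M N := (btens (@scr M) (@scl N)).
Notation "m ⊗ n" := (bpure (@scr _) (@scl _) m n) (at level 40, left associativity).

Lemma bilin_bal (M N W : lmodType k) (f : M -> N -> W) :
  bilin f -> balanced (@scr M) (@scl N) f.
Proof.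
move=> [fl fr]; split=> // m a n.
by rewrite /scr /scl (linZ (fl n)) (linZ (fr m)).
Qed.

Lemma gtens_bal (M N : gvect) g (m : M) (a : k) (n : N) :
  gt_fun (@scr M) (@scl N) g (scr m a) n = gt_fun (@scr M) (@scl N) g m (scl a n).
Proof. by case: (bilin_bal (gt_fun_bilin (@scr M) (@scl N) g)) => _; apply. Qed.

Definition gtens (M N : gvect) : gvect := gbtens (@gtens_bal M N).

Lemma homog_pure (M N : gvect) h l (m : M) (n : N) : homog h m -> homog l n ->
  @homog (gtens M N) (h + l) (m ⊗ n).
Proof. exact: homog_bpure. Qed.

Definition tlift (M N W : lmodType k) (f : M -> N -> W) : tens M N -> W := blift f.

Lemma tlift_pure (M N W : lmodType k) (f : M -> N -> W) m n :
  bilin f -> tlift f (m ⊗ n) = f m n.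
Proof. by move=> fb; rewrite /tlift (blift_pure (bilin_bal fb)). Qed.

Lemma tlift_lin (M N W : lmodType k) (f : M -> N -> W) : bilin f -> linear (tlift f).
Proof. by move=> fb; apply: (blift_lin (bilin_bal fb)). Qed.

Lemma pure_linl (M N : lmodType k) (n : N) : linear (fun m : M => m ⊗ n).
Proof. exact: bpure_linl. Qed.
Lemma pure_linr (M N : lmodType k) (m : M) : linear (fun n : N => m ⊗ n).
Proof. exact: bpure_linr. Qed.

Lemma tens_ext (M N W : lmodType k) (f g : tens M N -> W) : linear f -> linear g ->
  (forall m n, f (m ⊗ n) = g (m ⊗ n)) -> f =1 g.
Proof. exact: btens_ext. Qed.

Lemma htens_ext (M N : gvect) (W : lmodType k) (f f' : tens M N -> W) :
  linear f -> linear f' ->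
  (forall h l m n, homog h m -> homog l n -> f (m ⊗ n) = f' (m ⊗ n)) ->
  f =1 f'.
Proof. exact: hpure_ext. Qed.

(* only meaningful for linear f and g (tmap_pure) *)
Definition tmap (M N M' N' : lmodType k) (f : M -> M') (g : N -> N') :
  tens M N -> tens M' N' := tlift (fun m n => f m ⊗ g n).

Section Tmap.
Variables (M N M' N' : lmodType k) (f : M -> M') (g : N -> N').
Hypotheses (fl : linear f) (gl : linear g).

Lemma tmap_bilin : bilin (fun m n => f m ⊗ g n).
Proof.
split=> [n|m]; first exact: (lin_comp (pure_linl (g n)) fl).
exact: (lin_comp (pure_linr (f m)) gl).
Qed.
Lemma tmap_pure m n : tmap f g (m ⊗ n) = f m ⊗ g n.
Proof. exact: tlift_pure tmap_bilin. Qed.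
Lemma tmap_lin : linear (tmap f g).
Proof. exact: tlift_lin tmap_bilin. Qed.
End Tmap.

Definition tassoc (M N P : lmodType k) : tens (tens M N) P -> tens M (tens N P) :=
  tlift (fun x p => tlift (fun m n => m ⊗ (n ⊗ p)) x).

Section Tassoc.
Variables M N P : lmodType k.

Lemma tassoc_bilin1 (p : P) : bilin (fun (m : M) (n : N) => m ⊗ (n ⊗ p)).
Proof.
split=> [n|m]; first exact: pure_linl.
exact: (lin_comp (pure_linr m) (pure_linl p)).
Qed.

Lemma tassoc_bilin : bilin (fun (x : tens M N) (p : P) => tlift (fun m n => m ⊗ (n ⊗ p)) x).
Proof.
split=> [p|x]; first exact: tlift_lin (tassoc_bilin1 p).
apply: blift_linf => m n; exact: (lin_comp (pure_linr m) (pure_linr n)).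
Qed.

Lemma tassoc_lin : linear (@tassoc M N P).
Proof. exact: tlift_lin tassoc_bilin. Qed.

Lemma tassoc_pure m n p : @tassoc M N P ((m ⊗ n) ⊗ p) = m ⊗ (n ⊗ p).
Proof.
by rewrite /tassoc (tlift_pure _ _ tassoc_bilin) (tlift_pure _ _ (tassoc_bilin1 p)).
Qed.
End Tassoc.

End Grading.

Notation tens M N := (btens (@scr _ M) (@scl _ N)).
Notation "m ⊗ n" := (bpure (@scr _ _) (@scl _ _) m n) (at level 40, left associativity).

Section ColourAlgebra.
Variables (k : fieldType) (G : zmodType).

(* The abelian grading group is written additively, so that e is 0. *)
Record bicharacter := Bicharacter {
  bich :> G -> G -> k;
  bich_neq0 : forall g h, bich g h != 0;
  bichDr : forall g h h', bich g (h + h') = bich g h * bich g h';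
  bichDl : forall g g' h, bich (g + g') h = bich g h * bich g' h
}.

Lemma bich0r (chi : bicharacter) g : chi g 0 = 1.
Proof.
by apply: (mulfI (bich_neq0 chi g 0)); rewrite -bichDr addr0 mulr1.
Qed.

Lemma bich0l (chi : bicharacter) g : chi 0 g = 1.
Proof.
by apply: (mulfI (bich_neq0 chi 0 g)); rewrite -bichDl addr0 mulr1.
Qed.

Definition triv_pr (g : G) (a : k^o) : k^o := if g == 0 then a else 0.

Lemma triv_lin g : linear (triv_pr g).
Proof. by move=> a u v; rewrite /triv_pr; case: eqP; rewrite ?scaler0 ?addr0. Qed.
Lemma triv_prK g h a : triv_pr g (triv_pr h a) = if g == h then triv_pr h a else 0.
Proof.
rewrite /triv_pr; case: (h =P 0) => [->|_]; first by case: eqP.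
by case: eqP; case: eqP.
Qed.
Lemma triv_sum a : exists2 s : seq G, uniq s & a = \sum_(g <- s) triv_pr g a.
Proof. by exists [:: 0] => //; rewrite big_cons big_nil addr0 /triv_pr eqxx. Qed.

Definition gunit : gvect k G := GVect (Grading triv_lin triv_prK triv_sum).

(* not an algType, which would exclude the zero algebra *)
Record calg := CAlg {
  ca_v :> gvect k G;
  cmul : ca_v -> ca_v -> ca_v;
  cone : ca_v;
  cmul_bilin : bilin cmul;
  cmulA : associative cmul;
  cmul1l : left_id cone cmul;
  cmul1r : right_id cone cmul;
  cmul_deg : forall g h a b, homog g a -> homog h b -> homog (g + h) (cmul a b);
  cone_deg : homog 0 cone
}.

Record is_calg_hom (R R' : calg) (f : R -> R') : Prop := {
  ch_lin : linear f;
  ch_graded : graded f;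
  ch_mul : forall a b, f (cmul a b) = cmul (f a) (f b);
  ch_one : f (cone R) = cone R'
}.

Record is_gmod (R : calg) (M : gvect k G) (act : R -> M -> M) : Prop := {
  act_bilin : bilin act;
  actA : forall a b m, act (cmul a b) m = act a (act b m);
  act1 : forall m, act (cone R) m = m;
  act_deg : forall g h a m, homog g a -> homog h m -> homog (g + h) (act a m)
}.

Record gmod (R : calg) := GMod {
  gm_v :> gvect k G;
  gm_act : R -> gm_v -> gm_v;
  gm_actP : is_gmod gm_act
}.

Record is_gmod_hom (R : calg) (M N : gmod R) (f : M -> N) : Prop := {
  gmh_lin : linear f;
  gmh_graded : graded f;
  gmh_act : forall b m, f (gm_act b m) = gm_act b (f m)
}.

Variable chi : bicharacter.

(* For mu : P x P' -> Q and nu : V x V' -> W, the map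
   (p (x) v, p' (x) v') |-> (|v| / |p'|) mu(p, p') (x) nu(v, v'). *)
Definition ctw (P P' V V' : gvect k G) (Q W : lmodType k)
    (mu : P -> P' -> Q) (nu : V -> V' -> W)
    (x : tens P V) (y : tens P' V') : tens Q W :=
  tlift (fun p v => tlift (fun p' v' =>
    gext (fun g v => gext (fun h p' => chi g h *: (mu p p' ⊗ nu v v')) p') v) y) x.

Section Ctw.
Variables (P P' V V' : gvect k G) (Q W : lmodType k).
Variables (mu : P -> P' -> Q) (nu : V -> V' -> W).
Hypotheses (mub : bilin mu) (nub : bilin nu).

Definition ctw_core (p : P) (v : V) (p' : P') (v' : V') : tens Q W :=
  gext (fun g v => gext (fun h p' => chi g h *: (mu p p' ⊗ nu v v')) p') v.

Let ctw_core_in g h p v v' : linear (fun p' => chi g h *: (mu p p' ⊗ nu v v')).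
Proof. by apply: lin_scale; apply: (lin_comp (pure_linl _)); case: mub. Qed.

Lemma ctw_core_lin1 v p' v' : linear (fun p => ctw_core p v p' v').
Proof.
apply: gext_linf => g {}v; apply: gext_linf => h {}p'; apply: lin_scale.
by apply: (lin_comp (pure_linl _)); case: mub.
Qed.
Lemma ctw_core_lin2 p p' v' : linear (fun v => ctw_core p v p' v').
Proof.
apply: gext_lin => g; apply: gext_linf => h {}p'; apply: lin_scale.
by apply: (lin_comp (pure_linr _)); case: nub.
Qed.
Lemma ctw_core_lin3 p v v' : linear (fun p' => ctw_core p v p' v').
Proof. by apply: gext_linf => g {}v; apply: gext_lin => h; apply: ctw_core_in. Qed.
Lemma ctw_core_lin4 p v p' : linear (fun v' => ctw_core p v p' v').
Proof.
apply: gext_linf => g {}v; apply: gext_linf => h {}p'; apply: lin_scale.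
by apply: (lin_comp (pure_linr _)); case: nub.
Qed.

Lemma ctw_bilin_in p v : bilin (ctw_core p v).
Proof. by split=> [v'|p']; [apply: ctw_core_lin3|apply: ctw_core_lin4]. Qed.

Lemma ctw_bilin_out y : bilin (fun p v => tlift (ctw_core p v) y).
Proof.
split=> [v|p]; apply: blift_linf => p' v'; [exact: ctw_core_lin1|exact: ctw_core_lin2].
Qed.

Lemma ctw_linl y : linear (fun x => ctw mu nu x y).
Proof. exact: tlift_lin (ctw_bilin_out y). Qed.

Lemma ctw_linr x : linear (ctw mu nu x).
Proof. by apply: blift_linf => p v; apply: tlift_lin; apply: ctw_bilin_in. Qed.

Lemma ctw_pure g h p v p' v' : homog g v -> homog h p' ->
  ctw mu nu (p ⊗ v) (p' ⊗ v') = chi g h *: (mu p p' ⊗ nu v v').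
Proof.
move=> hv hp'; rewrite /ctw (tlift_pure _ _ (ctw_bilin_out _)).
rewrite (tlift_pure _ _ (ctw_bilin_in _ _)) /ctw_core (gext_homog _ hv); last first.
  move=> g'; apply: gext_eq0 => h' p''.
  by rewrite (lin0 (nub.1 v')) (lin0 (pure_linr _)) scaler0.
rewrite (gext_homog _ hp') // => h'.
by rewrite (lin0 (mub.2 p)) (lin0 (pure_linl _)) scaler0.
Qed.

End Ctw.

Lemma ctw_deg (P P' V V' Q W : gvect k G) (mu : P -> P' -> Q) (nu : V -> V' -> W) :
  bilin mu -> bilin nu ->
  (forall g h p p', homog g p -> homog h p' -> homog (g + h) (mu p p')) ->
  (forall g h v v', homog g v -> homog h v' -> homog (g + h) (nu v v')) ->
  forall g h (x : gtens P V) (y : gtens P' V'), homog g x -> homog h y ->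
  @homog _ _ (gtens Q W) (g + h) (ctw mu nu x y).
Proof.
move=> mub nub mud nud g h x y hx hy.
apply: (@gbtens_deg _ _ _ _ _ _ _ _ (gtens Q W) (fun x => ctw mu nu x y)) hx => //.
  exact: ctw_linl.
move=> a b p v hp hv; rewrite addrC.
apply: (@gbtens_deg _ _ _ _ _ _ _ _ (gtens Q W) (ctw mu nu _)) hy => //.
  exact: ctw_linr.
move=> c d p' v' hp' hv'; rewrite (ctw_pure mub nub p v' hv hp').
apply: (@homogZ _ _ (gtens Q W)).
have -> : c + d + (a + b) = (a + c) + (b + d) by rewrite addrC addrACA.
by apply: homog_pure; [apply: mud|apply: nud].
Qed.

Record chopf := CHopf {
  ch_a :> calg;
  Delta : ch_a -> tens ch_a ch_a;
  eps : ch_a -> k;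
  antip : ch_a -> ch_a;
  Delta_lin : linear Delta;
  Delta_graded : @graded _ _ ch_a (gtens ch_a ch_a) Delta;
  eps_lin : linear (eps : ch_a -> k^o);
  eps_graded : @graded _ _ ch_a gunit eps;
  antip_lin : linear antip;
  antip_graded : graded antip;
  Delta_coassoc : forall h, tassoc (tmap Delta id (Delta h)) = tmap id Delta (Delta h);
  Delta_counitl : forall h, tlift (fun h1 h2 => eps h1 *: h2) (Delta h) = h;
  Delta_counitr : forall h, tlift (fun h1 h2 => eps h2 *: h1) (Delta h) = h;
  eps_one : eps (cone ch_a) = 1;
  eps_mul : forall h h', eps (cmul h h') = eps h * eps h';
  Delta_one : Delta (cone ch_a) = cone ch_a ⊗ cone ch_a;
  Delta_mul : forall h h',
    Delta (cmul h h') = ctw (@cmul ch_a) (@cmul ch_a) (Delta h) (Delta h');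
  antip_r : forall h,
    tlift (fun h1 h2 => cmul h1 (antip h2)) (Delta h) = eps h *: cone ch_a;
  antip_l : forall h,
    tlift (fun h1 h2 => cmul (antip h1) h2) (Delta h) = eps h *: cone ch_a
}.

Section Comodules.
Variable H : chopf.

Record is_gcomod (M : gvect k G) (co : M -> tens H M) : Prop := {
  co_lin : linear co;
  co_graded : @graded _ _ M (gtens H M) co;
  co_coassoc : forall m, tassoc (tmap (@Delta H) id (co m)) = tmap id co (co m);
  co_counit : forall m, tlift (fun h m' => eps h *: m') (co m) = m
}.

Record gcomod := GComod {
  cm_v :> gvect k G;
  cm_co : cm_v -> tens H cm_v;
  cm_coP : is_gcomod cm_co
}.

Lemma Delta_is_gcomod : is_gcomod (@Delta H).
Proof.
split; [exact: Delta_lin|exact: Delta_graded|exact: Delta_coassoc|exact: Delta_counitl].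
Qed.

Definition hopf_comod : gcomod := GComod Delta_is_gcomod.

Record is_gcolinear (M N : gcomod) (f : M -> N) : Prop := {
  gcl_lin : linear f;
  gcl_graded : graded f;
  gcl_co : forall m, cm_co (f m) = tmap id f (cm_co m)
}.

Record ccalg := CCAlg {
  cc_a :> calg;
  cc_co : cc_a -> tens H cc_a;
  cc_coP : is_gcomod cc_co;
  cc_one : cc_co (cone cc_a) = cone H ⊗ cone cc_a;
  cc_mul : forall a a',
    cc_co (cmul a a') = ctw (@cmul H) (@cmul cc_a) (cc_co a) (cc_co a')
}.

Definition cc_comod (A : ccalg) : gcomod := GComod (cc_coP A).

Record hmod (A : ccalg) := HMod {
  hm_c :> gcomod;
  hm_act : A -> hm_c -> hm_c;
  hm_actP : is_gmod hm_act;
  hm_compat : forall a m,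
    cm_co (hm_act a m) = ctw (@cmul H) hm_act (cc_co a) (cm_co m)
}.

Record is_hmod_hom (A : ccalg) (M N : hmod A) (f : M -> N) : Prop := {
  hmh_colin : is_gcolinear f;
  hmh_act : forall a m, f (hm_act a m) = hm_act a (f m)
}.

Section Coinvariants.
Variable M : gcomod.

Definition is_coinv : {pred M} := fun m => `[< cm_co m = cone H ⊗ m >].

Lemma is_coinvP m : reflect (cm_co m = cone H ⊗ m) (m \in is_coinv).
Proof. exact: asboolP. Qed.

Lemma is_coinv_submod : submod_closed is_coinv.
Proof.
have col := co_lin (cm_coP M).
split=> [|a u v /is_coinvP uE /is_coinvP vE]; apply/is_coinvP.
  by rewrite (lin0 col) (lin0 (pure_linr _)).
by rewrite col uE vE pure_linr.
Qed.

Record coinv := Coinv { coinv_val : M; _ : coinv_val \in is_coinv }.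
HB.instance Definition _ := [isSub for coinv_val].
HB.instance Definition _ := [Choice of coinv by <:].
HB.instance Definition _ :=
  GRing.SubChoice_isSubLmodule.Build k M is_coinv coinv is_coinv_submod.

Lemma coinvE (u : coinv) : cm_co (coinv_val u) = cone H ⊗ coinv_val u.
Proof. by apply/is_coinvP; case: u. Qed.

Lemma coinv_val_lin : linear coinv_val.
Proof. by move=> a u v; rewrite -[coinv_val]/(val) linearP. Qed.

Lemma coinv_val_inj : injective coinv_val. Proof. exact: val_inj. Qed.

Lemma is_coinv_gc g m : m \in is_coinv -> gc g m \in is_coinv.
Proof.
move=> /is_coinvP mE; apply/is_coinvP.
have /(@degP _ _ _ (gtens H M) _ 0 (co_lin (cm_coP M))) cod : forall g m, homog g m ->
    @homog _ _ (gtens H M) (g + 0) (cm_co m).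
  by move=> h m'; rewrite addr0; apply: co_graded (cm_coP M) h m'.
have := cod g m; rewrite addr0 => <-; rewrite mE.
move: m {mE}; apply: homog_ext => [||h m hm].
- exact: (lin_comp (@gc_lin _ _ (gtens H M) _) (pure_linr _)).
- exact: lin_comp (pure_linr _) (gc_lin _).
rewrite (gc_homog g (homog_pure (cone_deg H) hm)) (gc_homog g hm) add0r.
by case: eqP => // _; rewrite (lin0 (pure_linr _)).
Qed.

Definition coinv_pr g (u : coinv) : coinv := Coinv (is_coinv_gc g (valP u)).

Lemma coinv_pr_lin g : linear (coinv_pr g).
Proof.
move=> a u v; apply: coinv_val_inj; rewrite coinv_val_lin /=.
exact: gc_lin.
Qed.

Lemma coinv_prK g h u : coinv_pr g (coinv_pr h u) = if g == h then coinv_pr h u else 0.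
Proof.
by apply: coinv_val_inj; rewrite /= gcK; case: eqP.
Qed.

Lemma coinv_pr_sum u : exists2 s : seq G, uniq s & u = \sum_(g <- s) coinv_pr g u.
Proof.
exists (gsupp (coinv_val u)); first exact: gsupp_uniq.
by apply: coinv_val_inj; rewrite (lin_sum coinv_val_lin); apply: gsupp_sum.
Qed.

Definition gcoinv : gvect k G := GVect (Grading coinv_pr_lin coinv_prK coinv_pr_sum).

Lemma homog_coinv g (u : gcoinv) : homog g u <-> homog g (coinv_val u).
Proof. by split=> [/(congr1 coinv_val)|h] //; apply: coinv_val_inj. Qed.

End Coinvariants.

Lemma ctw_coinv (A : calg) (M : gvect k G) (act : A -> M -> M) (a : A) (m : M) :
  bilin act ->
  ctw (@cmul H) act (cone H ⊗ a) (cone H ⊗ m) = cone H ⊗ act a m.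
Proof.
move=> actb; move: a; apply: homog_ext => [||g a ha].
- exact: (lin_comp (ctw_linl (cmul_bilin H) actb _) (pure_linr _)).
- exact: (lin_comp (pure_linr _) (actb.1 m)).
by rewrite (ctw_pure (cmul_bilin H) actb _ _ ha (cone_deg H)) bich0r scale1r cmul1l.
Qed.

Section CoinvAlgebra.
Variable A : ccalg.
Let AC : gcomod := cc_comod A.

Lemma coinv_mul_subproof (a b : coinv AC) :
  cmul (coinv_val a) (coinv_val b) \in @is_coinv AC.
Proof.
apply/is_coinvP; rewrite [LHS]cc_mul -[cc_co (coinv_val a)]/(@cm_co AC _).
rewrite -[cc_co (coinv_val b)]/(@cm_co AC _) !coinvE.
exact: ctw_coinv (cmul_bilin A).
Qed.

Lemma coinv_one_subproof : cone A \in @is_coinv AC.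
Proof. by apply/is_coinvP; apply: cc_one. Qed.

Definition coinv_mul (a b : gcoinv AC) : gcoinv AC := Coinv (coinv_mul_subproof a b).
Definition coinv_one : gcoinv AC := Coinv coinv_one_subproof.

Lemma coinv_mul_bilin : bilin coinv_mul.
Proof.
split=> u a v w; apply: coinv_val_inj; rewrite coinv_val_lin /=.
- exact: (cmul_bilin A).1.
- exact: (cmul_bilin A).2.
Qed.

Lemma coinv_mulA : associative coinv_mul.
Proof. by move=> a b c; apply: coinv_val_inj; apply: cmulA. Qed.
Lemma coinv_mul1l : left_id coinv_one coinv_mul.
Proof. by move=> a; apply: coinv_val_inj; apply: cmul1l. Qed.
Lemma coinv_mul1r : right_id coinv_one coinv_mul.
Proof. by move=> a; apply: coinv_val_inj; apply: cmul1r. Qed.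
Lemma coinv_mul_deg g h (a b : gcoinv AC) :
  homog g a -> homog h b -> homog (g + h) (coinv_mul a b).
Proof. by move=> /homog_coinv ha /homog_coinv hb; apply/homog_coinv/cmul_deg. Qed.
Lemma coinv_one_deg : homog 0 coinv_one.
Proof. exact/homog_coinv/cone_deg. Qed.

Definition coinv_alg : calg :=
  CAlg coinv_mul_bilin coinv_mulA coinv_mul1l coinv_mul1r coinv_mul_deg coinv_one_deg.

Lemma homogB g (b : coinv_alg) : homog g b -> @homog _ _ A g (coinv_val b).
Proof. by move=> /(congr1 (@coinv_val AC)). Qed.

Section CoinvModule.
Variable M : hmod A.

Lemma coinv_act_subproof (b : coinv AC) (m : coinv M) :
  hm_act (coinv_val b) (coinv_val m) \in @is_coinv M.
Proof.
apply/is_coinvP; rewrite hm_compat -[cc_co (coinv_val b)]/(@cm_co AC _) !coinvE.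
exact: ctw_coinv (act_bilin (hm_actP M)).
Qed.

Definition coinv_act (b : coinv_alg) (m : gcoinv M) : gcoinv M :=
  Coinv (coinv_act_subproof b m).

Lemma coinv_actP : is_gmod coinv_act.
Proof.
have P := hm_actP M.
split.
- split=> u a v w; apply: coinv_val_inj; rewrite coinv_val_lin /=.
  + exact: (act_bilin P).1.
  + exact: (act_bilin P).2.
- by move=> a b m; apply: coinv_val_inj; apply: actA P _ _ _.
- by move=> m; apply: coinv_val_inj; apply: act1 P _.
- by move=> g h a m /homog_coinv ha /homog_coinv hm; apply/homog_coinv/(act_deg P).
Qed.

Definition coinv_mod : gmod coinv_alg := GMod coinv_actP.

End CoinvModule.
End CoinvAlgebra.
End Comodules.
End ColourAlgebra.

Record category := Category {
  obj :> Type;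
  mor : obj -> obj -> Type;
  idm : forall X, mor X X;
  cmp : forall X Y Z, mor Y Z -> mor X Y -> mor X Z;
  cmpA : forall X Y Z T (h : mor Z T) (g : mor Y Z) (f : mor X Y),
    cmp h (cmp g f) = cmp (cmp h g) f;
  cmp1m : forall X Y (f : mor X Y), cmp (idm Y) f = f;
  cmpm1 : forall X Y (f : mor X Y), cmp f (idm X) = f
}.
Arguments idm {c} X.
Arguments cmp {c X Y Z} g f.

Definition is_iso (C : category) (X Y : C) (f : mor X Y) : Prop :=
  exists g : mor Y X, cmp g f = idm X /\ cmp f g = idm Y.

Record functor (C D : category) := Functor {
  fob :> C -> D;
  fmor : forall X Y, mor X Y -> mor (fob X) (fob Y);
  fmor_id : forall X, fmor (idm X) = idm (fob X);
  fmor_cmp : forall X Y Z (g : mor Y Z) (f : mor X Y),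
    fmor (cmp g f) = cmp (fmor g) (fmor f)
}.

Record adjunction (C D : category) (L : functor C D) (R : functor D C) := Adjunction {
  adj_unit : forall X, mor X (R (L X));
  adj_counit : forall Y, mor (L (R Y)) Y;
  adj_unit_nat : forall X X' (f : mor X X'),
    cmp (fmor R (fmor L f)) (adj_unit X) = cmp (adj_unit X') f;
  adj_counit_nat : forall Y Y' (f : mor Y Y'),
    cmp f (adj_counit Y) = cmp (adj_counit Y') (fmor L (fmor R f));
  adj_triangleL : forall X, cmp (adj_counit (L X)) (fmor L (adj_unit X)) = idm (L X);
  adj_triangleR : forall Y, cmp (fmor R (adj_counit Y)) (adj_unit (R Y)) = idm (R Y)
}.

Definition inverse_equivalences (C D : category) (L : functor C D) (R : functor D C)
    (a : adjunction L R) : Prop :=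
  (forall X, is_iso (adj_unit a X)) /\ (forall Y, is_iso (adj_counit a Y)).

Section GradedModules.
Variables (k : fieldType) (G : zmodType) (R : calg k G).

Record gmod_hom (M N : gmod R) := GModHom {
  gmh_fun :> M -> N;
  gmh_homP : is_gmod_hom gmh_fun
}.

Lemma gmod_hom_eq (M N : gmod R) (f g : gmod_hom M N) : f =1 g -> f = g.
Proof.
case: f g => [f fP] [g gP] /= /funext fg; subst g.
by congr GModHom; apply: Prop_irrelevance.
Qed.

Lemma gmod_id_homP (M : gmod R) : is_gmod_hom (fun m : M => m).
Proof. by split. Qed.

Lemma gmod_cmp_homP (M N P : gmod R) (g : gmod_hom N P) (f : gmod_hom M N) :
  is_gmod_hom (fun m => g (f m)).
Proof.
case: f g => [f [fl fg fa]] [g [gl gg ga]] /=; split.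
- exact: lin_comp gl fl.
- by move=> d m hm; apply/gg/fg.
- by move=> b m; rewrite fa ga.
Qed.

Definition gmodC : category.
Proof.
refine (@Category (gmod R) gmod_hom (fun M => GModHom (gmod_id_homP M))
  (fun _ _ _ g f => GModHom (gmod_cmp_homP g f)) _ _ _);
  by move=> *; apply: gmod_hom_eq.
Defined.

End GradedModules.

Section HopfModules.
Variables (k : fieldType) (G : zmodType) (chi : bicharacter k G).
Variables (H : chopf chi) (A : ccalg H).

Record hmod_hom (M N : hmod A) := HModHom {
  hmh_fun :> M -> N;
  hmh_homP : is_hmod_hom hmh_fun
}.

Lemma hmod_hom_eq (M N : hmod A) (f g : hmod_hom M N) : f =1 g -> f = g.
Proof.
case: f g => [f fP] [g gP] /= /funext fg; subst g.
by congr HModHom; apply: Prop_irrelevance.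
Qed.

Lemma tmap_id (M N : lmodType k) (x : tens M N) : tmap id id x = x.
Proof.
move: x; apply: tens_ext; [exact: tmap_lin|by []|].
by move=> m n; rewrite tmap_pure.
Qed.

Lemma tmap_comp (M N M' N' M'' N'' : lmodType k) (f' : M' -> M'') (g' : N' -> N'')
    (f : M -> M') (g : N -> N') : linear f -> linear g -> linear f' -> linear g' ->
  forall x : tens M N, tmap f' g' (tmap f g x) = tmap (f' \o f) (g' \o g) x.
Proof.
move=> fl gl fl' gl'; apply: tens_ext.
- apply: lin_comp; exact: tmap_lin.
- by apply: tmap_lin; apply: lin_comp.
- by move=> m n; rewrite !tmap_pure //; apply: lin_comp.
Qed.

Lemma hmod_id_homP (M : hmod A) : is_hmod_hom (fun m : M => m).
Proof. by split=> //; split=> // m; rewrite tmap_id. Qed.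

Lemma hmod_cmp_homP (M N P : hmod A) (g : hmod_hom N P) (f : hmod_hom M N) :
  is_hmod_hom (fun m => g (f m)).
Proof.
case: f g => [f [[fl fg fc] fa]] [g [[gl gg gc] ga]] /=; split; first split.
- exact: lin_comp gl fl.
- by move=> d m hm; apply/gg/fg.
- by move=> m; rewrite gc fc tmap_comp.
- by move=> b m; rewrite fa ga.
Qed.

Definition hmodC : category.
Proof.
refine (@Category (hmod A) hmod_hom (fun M => HModHom (hmod_id_homP M))
  (fun _ _ _ g f => HModHom (hmod_cmp_homP g f)) _ _ _);
  by move=> *; apply: hmod_hom_eq.
Defined.

Let B := coinv_alg A.

Section Coinv_functor.
Variables (M N : hmod A) (f : hmod_hom M N).

Lemma coinv_map_subproof (u : coinv M) : f (coinv_val u) \in @is_coinv _ _ _ _ N.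
Proof.
case: f => g [[gl gg gc] ga] /=; apply/is_coinvP.
by rewrite gc coinvE tmap_pure.
Qed.

Definition coinv_map (u : coinv_mod M) : coinv_mod N := Coinv (coinv_map_subproof u).

Lemma coinv_map_homP : is_gmod_hom coinv_map.
Proof.
case: (hmh_homP f) => [[gl gg gc] ga]; split.
- by move=> a u v; apply: coinv_val_inj; apply: gl.
- by move=> g u /homog_coinv hu; apply/homog_coinv/gg.
- by move=> b u; apply: coinv_val_inj; apply: ga.
Qed.

End Coinv_functor.

Definition coinvF : functor hmodC (gmodC B).
Proof.
refine (@Functor hmodC (gmodC B) (fun M : hmod A => coinv_mod M)
  (fun M N f => GModHom (coinv_map_homP f)) _ _).
- by move=> M; apply: gmod_hom_eq => u; apply: coinv_val_inj.
- by move=> M N P g f; apply: gmod_hom_eq => u; apply: coinv_val_inj.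
Defined.

Definition raB (a : A) (b : B) : A := cmul a (coinv_val b).

Section TensorB.
Variable N : gmod B.

Definition laB (b : B) (n : N) : N := gm_act b n.

Definition pureB (a : A) (n : N) : btens raB laB := bpure raB laB a n.

Lemma raB_linl b : linear (raB^~ b).
Proof. exact: (cmul_bilin A).1. Qed.
Lemma raB_linr a : linear (raB a).
Proof. by move=> c u v; rewrite /raB coinv_val_lin; apply: (cmul_bilin A).2. Qed.

Lemma tensB_bal g a b n : gt_fun raB laB g (raB a b) n = gt_fun raB laB g a (laB b n).
Proof.
have [gtl gtr] := gt_fun_bilin raB laB g.
have [all alr] := act_bilin (gm_actP N).
move: b; apply: homog_ext => [||h b hb].
- exact: lin_comp (gtl n) (raB_linr a).
- exact: lin_comp (gtr a) (all n).
move: a; apply: homog_ext => [||l a ha].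
- exact: lin_comp (gtl n) (raB_linl b).
- exact: gtl.
have hab : homog (l + h) (raB a b) by apply: cmul_deg => //; apply: homogB.
rewrite (gt_fun_homog _ _ _ _ hab) (gt_fun_homog _ _ _ _ ha) bpure_bal.
congr bpure; move: n; apply: homog_ext => [||d n hn].
- exact: lin_comp (alr b) (gc_lin _).
- exact: lin_comp (gc_lin _) (alr b).
rewrite (gc_homog _ hn) (gc_homog _ (act_deg (gm_actP N) hb hn)).
rewrite !subr_eq (_ : h + d + l = d + (l + h)); last by rewrite addrC addrA addrC.
by case: eqP => // _; exact: lin0 (alr b).
Qed.

Definition tensB : gvect k G := gbtens tensB_bal.

Lemma pureB_linl n : linear (pureB^~ n). Proof. exact: bpure_linl. Qed.
Lemma pureB_linr a : linear (pureB a). Proof. exact: bpure_linr. Qed.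
Lemma pureB_bal (a : A) (b : B) (n : N) : pureB (cmul a (coinv_val b)) n = pureB a (gm_act b n).
Proof. exact: bpure_bal. Qed.

Lemma tensB_ext (W : lmodType k) (f g : tensB -> W) : linear f -> linear g ->
  (forall a n, f (pureB a n) = g (pureB a n)) -> f =1 g.
Proof. exact: btens_ext. Qed.

Definition tensB_act (a : A) : tensB -> tensB :=
  blift (fun a' n => pureB (cmul a a') n).

Lemma tensB_act_bal a : balanced raB laB (fun a' n => pureB (cmul a a') n).
Proof.
split; first split.
- by move=> n; apply: lin_comp (pureB_linl n) ((cmul_bilin A).2 a).
- by move=> a'; apply: pureB_linr.
- by move=> a' b n; rewrite /raB cmulA pureB_bal.
Qed.

Lemma tensB_actE a a' n : tensB_act a (pureB a' n) = pureB (cmul a a') n.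
Proof. exact: blift_pure (tensB_act_bal a) _ _. Qed.

Lemma tensB_act_linr a : linear (tensB_act a).
Proof. exact: blift_lin (tensB_act_bal a). Qed.

Lemma tensB_actP : is_gmod tensB_act.
Proof.
have linl x : linear (fun a => tensB_act a x).
  apply: blift_linf => a n; apply: lin_comp (pureB_linl n) ((cmul_bilin A).1 a).
split.
- by split=> [x|a]; [apply: linl|apply: tensB_act_linr].
- move=> a b; apply: tensB_ext => [||a' n].
  + exact: tensB_act_linr.
  + exact: lin_comp (tensB_act_linr _) (tensB_act_linr _).
  + by rewrite !tensB_actE cmulA.
- apply: tensB_ext => [||a' n]; [exact: tensB_act_linr|by []|].
  by rewrite tensB_actE cmul1l.
- move=> g h a x ha; rewrite [g + h]addrC; move: h x.
  apply: gbtens_deg; first exact: tensB_act_linr.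
  move=> h l a' n ha' hn; rewrite tensB_actE addrAC [h + g]addrC.
  by apply: homog_bpure => //; apply: cmul_deg.
Qed.

(* a (x)_B n |-> a_(-1) (x) (a_(0) (x)_B n) *)
Definition tensB_co : tensB -> tens H tensB :=
  blift (fun a n => tmap id (fun a0 => pureB a0 n : tensB) (cc_co a)).

Definition phi (n : N) : tens H A -> tens H tensB := tmap id (fun a0 => pureB a0 n : tensB).

Lemma phi_lin n : linear (phi n).
Proof. by apply: tmap_lin => //; apply: pureB_linl. Qed.
Lemma phi_pure n h a : phi n (h ⊗ a) = h ⊗ (pureB a n : tensB).
Proof. by rewrite /phi tmap_pure //; apply: pureB_linl. Qed.
Lemma phi_linr x : linear (fun n => phi n x).
Proof.
move=> a u v; move: x; apply: tens_ext => [||h b].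
- exact: phi_lin.
- by move=> c x y; rewrite !phi_lin !scalerDr !scalerA mulrC addrACA.
- by rewrite !phi_pure -pure_linr -pureB_linr.
Qed.

Lemma phi_ctw_one x (b : B) (n : N) :
  phi n (ctw chi (@cmul _ _ H) (@cmul _ _ A) x (cone H ⊗ coinv_val b)) = phi (gm_act b n) x.
Proof.
have Hb := cmul_bilin H; have Ab := cmul_bilin A.
move: x; apply: htens_ext => [||g h p a hp ha].
- exact: lin_comp (phi_lin n) (ctw_linl chi Hb Ab _).
- exact: phi_lin.
rewrite (ctw_pure chi Hb Ab _ _ ha (cone_deg H)) bich0r scale1r cmul1r !phi_pure.
by rewrite pureB_bal.
Qed.

Lemma tensB_co_bal : balanced raB laB (fun a n => phi n (cc_co a)).
Proof.
split; first split.
- by move=> n; apply: lin_comp (phi_lin n) (co_lin (cc_coP A)).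
- by move=> a; apply: phi_linr.
- move=> a b n; rewrite cc_mul -[cc_co (coinv_val b)]/(@cm_co _ _ _ _ (cc_comod A) _).
  by rewrite coinvE phi_ctw_one.
Qed.

Lemma tensB_coE a n : tensB_co (pureB a n) = phi n (cc_co a).
Proof. exact: blift_pure tensB_co_bal _ _. Qed.
Lemma tensB_co_lin : linear tensB_co.
Proof. exact: blift_lin tensB_co_bal. Qed.

Lemma phi_graded n l : homog l n -> forall g (x : gtens H A), homog g x ->
  @homog _ _ (gtens H tensB) (g + l) (phi n x).
Proof.
move=> hn; apply: (@gbtens_deg _ _ _ _ _ _ _ _ (gtens H tensB)); first exact: phi_lin.
move=> h d p a hp ha; rewrite phi_pure -addrA; apply: homog_pure => //.
exact: homog_bpure.
Qed.

Lemma tensB_coP : is_gcomod tensB_co.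
Proof.
have Dl := @Delta_lin _ _ _ H; have [cl cg cA cu] := cc_coP A.
have cBl := tensB_co_lin.
split=> //.
- apply: (@gbtens_graded _ _ _ _ _ _ _ _ (gtens H tensB)) => //.
  move=> h l a n ha hn; rewrite tensB_coE; apply: phi_graded => //.
  exact: cg.
- apply: tensB_ext => [||a n].
  + apply: lin_comp; first exact: tassoc_lin.
    by apply: lin_comp => //; apply: tmap_lin.
  + by apply: lin_comp => //; apply: tmap_lin.
  rewrite tensB_coE.
  have E x : tassoc (tmap (@Delta _ _ _ H) id (phi n x)) =
      tmap id (phi n) (tassoc (tmap (@Delta _ _ _ H) id x)).
    move: x; apply: tens_ext => [||h b].
    * apply: lin_comp; first exact: tassoc_lin.
      apply: lin_comp; [exact: tmap_lin|exact: phi_lin].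
    * apply: lin_comp; first by apply: tmap_lin => //; apply: phi_lin.
      apply: lin_comp; [exact: tassoc_lin|exact: tmap_lin].
    rewrite phi_pure !tmap_pure //; move: (Delta h); apply: tens_ext => [||u v].
    * apply: lin_comp; [exact: tassoc_lin|exact: pure_linl].
    * apply: lin_comp; first by apply: tmap_lin => //; apply: phi_lin.
      apply: lin_comp; [exact: tassoc_lin|exact: pure_linl].
    rewrite !tassoc_pure tmap_pure ?phi_pure //; exact: phi_lin.
  rewrite E cA; move: (cc_co a); apply: tens_ext => [||h b].
  + by apply: lin_comp; apply: tmap_lin => //; apply: phi_lin.
  + apply: lin_comp; [exact: tmap_lin|exact: phi_lin].
  rewrite phi_pure !tmap_pure //; last exact: phi_lin.
  by rewrite tensB_coE.
- have ub (V : gvect k G) : bilin (fun (h : H) (m : V) => eps h *: m).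
    split=> [m|h] a u v; first by rewrite [eps _](@eps_lin _ _ _ H) scalerDl -scalerA.
    by rewrite scalerDr !scalerA mulrC.
  apply: tensB_ext => [||a n]; [|by []|].
    by apply: lin_comp => //; apply: tlift_lin.
  rewrite tensB_coE -[in RHS](cu a).
  move: (cc_co a); apply: tens_ext => [||h b].
  + apply: lin_comp; [exact: tlift_lin|exact: phi_lin].
  + apply: (lin_comp (pureB_linl n)); exact: tlift_lin.
  by rewrite phi_pure !tlift_pure // (linZ (pureB_linl n)).
Qed.

Definition tensB_comod : gcomod H := GComod tensB_coP.

Lemma tensB_compat (a : A) (x : tensB_comod) :
  tensB_co (tensB_act a x) = ctw chi (@cmul _ _ H) tensB_act (cc_co a) (tensB_co x).
Proof.
have Hb := cmul_bilin H; have Ab := cmul_bilin A; have Tb := act_bilin tensB_actP.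
move: x; apply: tensB_ext => [||a' n].
- apply: lin_comp; [exact: tensB_co_lin|exact: tensB_act_linr].
- apply: lin_comp; [exact: ctw_linr|exact: tensB_co_lin].
rewrite tensB_actE !tensB_coE cc_mul.
move: (cc_co a) (cc_co a') => x y.
move: x; apply: htens_ext => [||g h p u hp hu].
- apply: lin_comp; [exact: phi_lin|exact: ctw_linl].
- exact: ctw_linl.
move: y; apply: htens_ext => [||g' h' p' u' hp' hu'].
- apply: lin_comp; [exact: phi_lin|exact: ctw_linr].
- apply: lin_comp; [exact: ctw_linr|exact: phi_lin].
rewrite phi_pure !(ctw_pure chi _ _ _ _ hu hp') // (linZ (phi_lin n)) phi_pure.
by rewrite tensB_actE.
Qed.

Definition tensB_hmod : hmod A := @HMod _ _ _ _ A tensB_comod _ tensB_actP tensB_compat.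

End TensorB.

Section TensorB_map.
Variables (N N' : gmod B) (f : gmod_hom N N').

Definition tensB_map : tensB_hmod N -> tensB_hmod N' :=
  blift (fun a n => pureB a (f n)).

Lemma tensB_map_bal : balanced raB (@laB N) (fun a n => pureB a (f n)).
Proof.
have [fl fg fa] := gmh_homP f; split; first split.
- by move=> n; apply: pureB_linl.
- by move=> a; apply: lin_comp (pureB_linr a) fl.
- by move=> a b n; rewrite pureB_bal /laB fa.
Qed.

Lemma tensB_mapE a n : tensB_map (pureB a n) = pureB a (f n).
Proof. exact: blift_pure tensB_map_bal _ _. Qed.
Lemma tensB_map_lin : linear tensB_map.
Proof. exact: blift_lin tensB_map_bal. Qed.

Lemma tensB_map_homP : is_hmod_hom tensB_map.
Proof.
have [fl fg fa] := gmh_homP f; split; first split.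
- exact: tensB_map_lin.
- apply: gbtens_graded; first exact: tensB_map_lin.
  by move=> h l a n ha hn; rewrite tensB_mapE; apply: homog_bpure => //; apply: fg.
- apply: tensB_ext => [||a n].
  + apply: lin_comp; [exact: tensB_co_lin|exact: tensB_map_lin].
  + apply: lin_comp; [apply: tmap_lin => //; exact: tensB_map_lin|exact: tensB_co_lin].
  rewrite tensB_mapE /= !tensB_coE; move: (cc_co a); apply: tens_ext => [||h b].
  + by apply: tmap_lin => //; apply: pureB_linl.
  + apply: lin_comp; apply: tmap_lin => //; [exact: tensB_map_lin|exact: pureB_linl].
  by rewrite !phi_pure tmap_pure ?tensB_mapE //; apply: tensB_map_lin.
- move=> a; apply: tensB_ext => [||a' n].
  + apply: lin_comp; [exact: tensB_map_lin|exact: tensB_act_linr].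
  + apply: lin_comp; [exact: tensB_act_linr|exact: tensB_map_lin].
  by rewrite /= tensB_actE !tensB_mapE tensB_actE.
Qed.

End TensorB_map.

Definition tensBF : functor (gmodC B) hmodC.
Proof.
refine (@Functor (gmodC B) hmodC tensB_hmod (fun N N' f => HModHom (tensB_map_homP f)) _ _).
- move=> N; apply: hmod_hom_eq; apply: tensB_ext; [exact: tensB_map_lin|by []|].
  by move=> a n /=; rewrite tensB_mapE.
- move=> N N' N'' g f; apply: hmod_hom_eq; apply: tensB_ext => [||a n].
  + exact: tensB_map_lin.
  + apply: lin_comp; exact: tensB_map_lin.
  by rewrite /= !tensB_mapE.
Defined.

Section Unit.
Variable N : gmod B.

Lemma eta_subproof (n : N) : pureB (cone A) n \in @is_coinv _ _ _ _ (tensB_hmod N).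
Proof.
apply/is_coinvP; by rewrite [LHS]tensB_coE cc_one phi_pure.
Qed.

(* n |-> 1_A (x)_B n *)
Definition eta (n : N) : coinv_mod (tensB_hmod N) := Coinv (eta_subproof n).

Lemma eta_homP : is_gmod_hom eta.
Proof.
split.
- by move=> a u v; apply: coinv_val_inj; apply: pureB_linr.
- move=> g n hn; apply/homog_coinv; rewrite -[g]add0r; apply: homog_bpure => //.
  exact: cone_deg.
- move=> b n; apply: coinv_val_inj => /=; rewrite tensB_actE cmul1r -pureB_bal.
  by rewrite cmul1l.
Qed.
End Unit.

Section Counit.
Variable M : hmod A.

(* a (x)_B m |-> a m *)
Definition alpha : tensB_hmod (coinv_mod M) -> M :=
  blift (fun (a : A) (m : coinv M) => hm_act a (coinv_val m)).

Lemma alpha_bal :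
  balanced raB (@laB (coinv_mod M)) (fun (a : A) (m : coinv M) => hm_act a (coinv_val m)).
Proof.
have [[al ar] aA _ _] := hm_actP M; split; first split.
- by move=> m; apply: al.
- by move=> a; apply: lin_comp (ar a) (@coinv_val_lin _ _ _ _ _).
- by move=> a b m; rewrite aA.
Qed.

Lemma alphaE a m : alpha (pureB a m) = hm_act a (coinv_val m).
Proof. exact: blift_pure alpha_bal _ _. Qed.
Lemma alpha_lin : linear alpha.
Proof. exact: blift_lin alpha_bal. Qed.

Lemma alpha_homP : is_hmod_hom alpha.
Proof.
have [[al ar] aA _ adeg] := hm_actP M; split; first split.
- exact: alpha_lin.
- apply: gbtens_graded; first exact: alpha_lin.
  by move=> h l a m ha /homog_coinv hm; rewrite alphaE; apply: adeg.
- apply: tensB_ext => [||a m].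
  + apply: lin_comp; [exact: co_lin (cm_coP M)|exact: alpha_lin].
  + apply: lin_comp; [apply: tmap_lin => //; exact: alpha_lin|exact: tensB_co_lin].
  rewrite alphaE /= tensB_coE hm_compat coinvE.
  have Hb := cmul_bilin H; have Mb := act_bilin (hm_actP M).
  move: (cc_co a); apply: htens_ext => [||g h p u hp hu].
  + exact: ctw_linl.
  + apply: lin_comp; apply: tmap_lin => //; [exact: alpha_lin|exact: pureB_linl].
  rewrite (ctw_pure chi Hb Mb _ _ hu (cone_deg H)) bich0r scale1r cmul1r.
  by rewrite phi_pure !tmap_pure ?alphaE //; apply: alpha_lin.
- move=> a; apply: tensB_ext => [||a' m].
  + apply: lin_comp; [exact: alpha_lin|exact: tensB_act_linr].
  + apply: lin_comp; [exact: ar|exact: alpha_lin].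
  by rewrite /= tensB_actE !alphaE aA.
Qed.
End Counit.

Definition tensB_coinv_adj : adjunction tensBF coinvF.
Proof.
refine (@Adjunction (gmodC B) hmodC tensBF coinvF
  (fun N => GModHom (eta_homP N)) (fun M => HModHom (alpha_homP M)) _ _ _ _).
- move=> N N' f; apply: gmod_hom_eq => n; apply: coinv_val_inj => /=.
  by rewrite tensB_mapE.
- move=> M M' f; apply: hmod_hom_eq; have [[fl _ _] fa] := hmh_homP f.
  apply: tensB_ext => [||a m].
  + apply: lin_comp; [exact: fl|exact: alpha_lin].
  + apply: lin_comp; [exact: alpha_lin|exact: tensB_map_lin].
  by rewrite /= tensB_mapE !alphaE fa.
- move=> N; apply: hmod_hom_eq; apply: tensB_ext => [|//|a n].
    apply: lin_comp; [exact: alpha_lin|exact: tensB_map_lin].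
  by rewrite /= tensB_mapE alphaE /= tensB_actE cmul1r.
- move=> M; apply: gmod_hom_eq => m; apply: coinv_val_inj => /=.
  by rewrite alphaE (act1 (hm_actP M)).
Defined.

Definition short_exact (U V W : lmodType k) (f : U -> V) (g : V -> W) : Prop :=
  [/\ injective f,
      forall v, g v = 0 <-> exists u, f u = v &
      forall w, exists v, g v = w].

Definition faithfully_flat : Prop :=
  forall (N N' N'' : gmod B) (f : gmod_hom N N') (g : gmod_hom N' N''),
    short_exact f g <-> short_exact (tensB_map f) (tensB_map g).

Definition laA (b : B) (a : A) : A := cmul (coinv_val b) a.

Lemma laA_P : is_gmod laA.
Proof.
have [bl br] := cmul_bilin A; split; first split.
- by move=> a c u v; rewrite /laA coinv_val_lin; apply: bl.
- by move=> b; apply: br.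
- by move=> b b' a; rewrite /laA cmulA.
- by move=> a; rewrite /laA cmul1l.
- by move=> g h b a /homogB hb ha; apply: cmul_deg.
Qed.

Definition regB : gmod B := GMod laA_P.


(* a (h (x) a') = (|a_(0)| / |h|) a_(-1) h (x) a_(0) a' *)
Definition HA_act (a : A) (y : gtens H A) : gtens H A :=
  ctw chi (@cmul _ _ H) (@cmul _ _ A) (cc_co a) y.

Definition HA_co (y : gtens H A) : tens H (gtens H A) :=
  tassoc (tmap (@Delta _ _ _ H) id y).

Let Hb := cmul_bilin H.
Let Ab := cmul_bilin A.

Lemma HA_ctwA (x y z : tens H A) :
  ctw chi (@cmul _ _ H) (@cmul _ _ A) (ctw chi (@cmul _ _ H) (@cmul _ _ A) x y) z =
  ctw chi (@cmul _ _ H) (@cmul _ _ A) x (ctw chi (@cmul _ _ H) (@cmul _ _ A) y z).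
Proof.
have L t := ctw_linl chi Hb Ab t; have R t := ctw_linr chi Hb Ab t.
move: x; apply: htens_ext => [||g1 g2 h1 a1 hh1 ha1].
- exact: lin_comp (L z) (L y).
- exact: L.
move: y; apply: htens_ext => [||g3 g4 h2 a2 hh2 ha2].
- exact: lin_comp (L z) (R _).
- exact: lin_comp (R _) (L z).
move: z; apply: htens_ext => [||g5 g6 h3 a3 hh3 ha3].
- exact: R.
- exact: lin_comp (R _) (R _).
rewrite (ctw_pure chi Hb Ab _ _ ha1 hh2) (ctw_pure chi Hb Ab _ _ ha2 hh3).
rewrite (linZ (L _)) (linZ (R _)).
rewrite (ctw_pure chi Hb Ab _ _ (cmul_deg ha1 ha2) hh3).
rewrite (ctw_pure chi Hb Ab _ _ ha1 (cmul_deg hh2 hh3)) !scalerA !cmulA.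
by rewrite bichDl bichDr; congr (_ *: _); rewrite mulrA mulrC.
Qed.

Lemma HA_actP : is_gmod HA_act.
Proof.
have [cl cg _ _] := cc_coP A.
split.
- split=> [y|a]; last exact: ctw_linr.
  exact: lin_comp (ctw_linl chi Hb Ab y) cl.
- by move=> a b y; rewrite /HA_act cc_mul HA_ctwA.
- rewrite /HA_act cc_one; apply: htens_ext => [||g h p a hp ha].
  + exact: ctw_linr.
  + by [].
  by rewrite (ctw_pure chi Hb Ab _ _ (cone_deg A) hp) bich0l scale1r !cmul1l.
- move=> g h a y ha hy; apply: ctw_deg => //.
  + by move=> *; apply: cmul_deg.
  + by move=> *; apply: cmul_deg.
  + exact: cg.
Qed.

Definition psi (a : A) : tens H H -> tens H (gtens H A) :=
  tmap id (fun h => (h ⊗ a : gtens H A)).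

Lemma psi_lin a : linear (psi a).
Proof. by apply: tmap_lin => //; apply: pure_linl. Qed.
Lemma psi_pure a h h' : psi a (h ⊗ h') = h ⊗ (h' ⊗ a : gtens H A).
Proof. by rewrite /psi tmap_pure //; apply: pure_linl. Qed.

Lemma HA_co_lin : linear HA_co.
Proof.
apply: lin_comp; first exact: tassoc_lin.
by apply: tmap_lin => //; apply: Delta_lin.
Qed.

Lemma HA_coE h a : HA_co (h ⊗ a) = psi a (Delta h).
Proof.
rewrite /HA_co tmap_pure //; last exact: Delta_lin.
move: (Delta h); apply: tens_ext => [||u v].
- apply: lin_comp; [exact: tassoc_lin|exact: pure_linl].
- exact: psi_lin.
by rewrite tassoc_pure psi_pure.
Qed.

Lemma psi_graded a l : homog l a -> forall g (x : gtens H H), homog g x ->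
  @homog _ _ (gtens H (gtens H A)) (g + l) (psi a x).
Proof.
move=> ha; apply: (@gbtens_deg _ _ _ _ _ _ _ _ (gtens H (gtens H A))).
  exact: psi_lin.
move=> h d p q hp hq; rewrite psi_pure -addrA; apply: homog_pure => //.
exact: homog_pure.
Qed.

Lemma HA_coP : @is_gcomod _ _ _ H (gtens H A) HA_co.
Proof.
have Dl := @Delta_lin _ _ _ H; have HAl := HA_co_lin.
split=> //.
- apply: (@gbtens_graded _ _ _ _ _ _ _ _ (gtens H (gtens H A))) => //.
  move=> h l p a hp ha; rewrite HA_coE; apply: psi_graded => //.
  exact: Delta_graded.
- apply: tens_ext => [||p a].
  + apply: lin_comp; first exact: tassoc_lin.
    by apply: lin_comp => //; apply: tmap_lin.
  + by apply: lin_comp => //; apply: tmap_lin.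
  rewrite HA_coE.
  have E x : tassoc (tmap (@Delta _ _ _ H) id (psi a x)) =
      tmap id (psi a) (tassoc (tmap (@Delta _ _ _ H) id x)).
    move: x; apply: tens_ext => [||h b].
    * apply: lin_comp; first exact: tassoc_lin.
      apply: lin_comp; [exact: tmap_lin|exact: psi_lin].
    * apply: lin_comp; first by apply: tmap_lin => //; apply: psi_lin.
      apply: lin_comp; [exact: tassoc_lin|exact: tmap_lin].
    rewrite psi_pure !tmap_pure //; move: (Delta h); apply: tens_ext => [||u v].
    * apply: lin_comp; [exact: tassoc_lin|exact: pure_linl].
    * apply: lin_comp; first by apply: tmap_lin => //; apply: psi_lin.
      apply: lin_comp; [exact: tassoc_lin|exact: pure_linl].
    rewrite !tassoc_pure tmap_pure ?psi_pure //; exact: psi_lin.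
  rewrite E Delta_coassoc; move: (Delta p); apply: tens_ext => [||h b].
  + by apply: lin_comp; apply: tmap_lin => //; apply: psi_lin.
  + apply: lin_comp; [exact: tmap_lin|exact: psi_lin].
  rewrite psi_pure !tmap_pure //; last exact: psi_lin.
  by rewrite HA_coE.
- have ub (V : gvect k G) : bilin (fun (h : H) (m : V) => eps h *: m).
    split=> [m|h] a u v; first by rewrite [eps _](@eps_lin _ _ _ H) scalerDl -scalerA.
    by rewrite scalerDr !scalerA mulrC.
  apply: tens_ext => [||p a]; [|by []|].
    by apply: lin_comp => //; apply: tlift_lin.
  rewrite HA_coE -[in RHS](Delta_counitl p).
  move: (Delta p); apply: tens_ext => [||h b].
  + apply: lin_comp; [exact: tlift_lin|exact: psi_lin].
  + apply: (lin_comp (pure_linl a)); exact: tlift_lin.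
  by rewrite psi_pure !tlift_pure // (linZ (pure_linl a)).
Qed.

Definition HA_comod : gcomod H := GComod HA_coP.

Let mHA := ctw chi (@cmul _ _ H) (@cmul _ _ A).

Lemma mHA_bilin : bilin (mHA : gtens H A -> gtens H A -> gtens H A).
Proof. by split=> [y|x]; [apply: ctw_linl|apply: ctw_linr]. Qed.

Lemma HA_compat1 (x : tens H A) (z : tens H (gtens H A)) :
  ctw chi (@cmul _ _ H) HA_act x z =
  ctw chi (@cmul _ _ H) (mHA : gtens H A -> gtens H A -> gtens H A)
    (tmap id (@cc_co _ _ _ _ A : A -> gtens H A) x) z.
Proof.
have [cl cg _ _] := cc_coP A; have Tb := act_bilin HA_actP; have mb := mHA_bilin.
move: x; apply: htens_ext => [||g h p a hp ha].
- exact: ctw_linl.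
- apply: lin_comp; [exact: ctw_linl|exact: tmap_lin].
move: z; apply: htens_ext => [||g' h' p' w hp' hw].
- exact: ctw_linr.
- exact: ctw_linr.
rewrite tmap_pure // (ctw_pure chi Hb Tb _ _ ha hp').
by rewrite (ctw_pure chi Hb mb _ _ (cg _ _ ha) hp').
Qed.

Lemma HA_compat2 g (a a' : A) (u v : tens H H) : homog g a ->
  psi (cmul a a') (ctw chi (@cmul _ _ H) (@cmul _ _ H) u
    (@gext _ _ (gtens H H) (gtens H H) (fun l v => chi g l *: v) v)) =
  ctw chi (@cmul _ _ H) (mHA : gtens H A -> gtens H A -> gtens H A) (psi a u) (psi a' v).
Proof.
move=> ha; have mb := mHA_bilin.
have gl : linear (@gext _ _ (gtens H H) (gtens H H) (fun l v => chi g l *: v)).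
  by apply: gext_lin => l; apply: lin_scale.
move: u; apply: htens_ext => [||h1 h2 u1 u2 hu1 hu2].
- apply: lin_comp; [exact: psi_lin|exact: ctw_linl].
- apply: lin_comp; [exact: ctw_linl|exact: psi_lin].
move: v; apply: htens_ext => [||l1 l2 v1 v2 hv1 hv2].
- apply: lin_comp; first exact: psi_lin.
  by apply: lin_comp => //; apply: ctw_linr.
- apply: lin_comp; [exact: ctw_linr|exact: psi_lin].
rewrite (gext_homog _ (homog_pure hv1 hv2)); last by move=> l; rewrite scaler0.
rewrite (linZ (ctw_linr chi Hb Hb _)) (ctw_pure chi Hb Hb _ _ hu2 hv1).
rewrite !(linZ (psi_lin _)) !psi_pure.
rewrite (ctw_pure chi Hb mb _ _ (homog_pure hu2 ha) hv1).
rewrite /mHA (ctw_pure chi Hb Ab _ _ ha hv2) (linZ (pure_linr _)) !scalerA.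
by rewrite bichDl bichDr; congr (_ *: _); rewrite mulrC mulrA.
Qed.

Lemma HA_compat3 (x y : tens H A) :
  HA_co (mHA x y) =
  ctw chi (@cmul _ _ H) (mHA : gtens H A -> gtens H A -> gtens H A) (HA_co x) (HA_co y).
Proof.
have mb := mHA_bilin; have Tl := HA_co_lin.
move: x; apply: htens_ext => [||g h p a hp ha].
- apply: (lin_comp Tl); exact: ctw_linl.
- by apply: lin_comp Tl; apply: ctw_linl.
move: y; apply: htens_ext => [||g' h' p' a' hp' ha'].
- apply: (lin_comp Tl); exact: ctw_linr.
- by apply: lin_comp Tl; apply: ctw_linr.
rewrite /mHA (ctw_pure chi Hb Ab _ _ ha hp') (linZ Tl) !HA_coE Delta_mul.
rewrite -/mHA -(HA_compat2 _ _ _ ha).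
rewrite (gext_homog _ (Delta_graded hp')); last by move=> l; rewrite scaler0.
by rewrite (linZ (ctw_linr chi Hb Hb _)) (linZ (psi_lin _)).
Qed.

Lemma HA_compat (a : A) (y : HA_comod) :
  HA_co (HA_act a y) = ctw chi (@cmul _ _ H) HA_act (cc_co a) (HA_co y).
Proof.
rewrite [LHS]HA_compat3 HA_compat1; congr (ctw _ _ _ _ _).
exact: co_coassoc (cc_coP A) a.
Qed.

Definition HA_hmod : hmod A := @HMod _ _ _ _ A HA_comod _ HA_actP HA_compat.

(* a (x)_B a' |-> a_(-1) (x) a_(0) a' *)
Definition can : tensB_hmod regB -> HA_hmod :=
  blift (fun a a' : A => tmap id (fun a0 => cmul a0 a') (cc_co a)).

Lemma can_bal :
  balanced raB (@laB regB) (fun a a' : A => tmap id (fun a0 => cmul a0 a') (cc_co a)).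
Proof.
have Ml (a' : A) : linear (fun a0 => cmul a0 a') by apply: Ab.1.
split; first split.
- move=> a'; apply: (lin_comp _ (co_lin (cc_coP A))); exact: tmap_lin.
- move=> a c u v; move: (cc_co a); apply: tens_ext => [||h b].
  + exact: tmap_lin.
  + by move=> d x y; rewrite !tmap_lin // !scalerDr !scalerA mulrC addrACA.
  by rewrite !tmap_pure // -pure_linr -Ab.2.
- move=> a b a'; rewrite cc_mul -[cc_co (coinv_val b)]/(@cm_co _ _ _ _ (cc_comod A) _).
  rewrite coinvE; move: (cc_co a); apply: htens_ext => [||g h p u hp hu].
  + by apply: lin_comp; [exact: tmap_lin|exact: ctw_linl].
  + exact: tmap_lin.
  rewrite (ctw_pure chi Hb Ab _ _ hu (cone_deg H)) bich0r scale1r cmul1r.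
  by rewrite !tmap_pure // /laB /= /laA cmulA.
Qed.

Lemma canE (a a' : A) :
  can (@pureB regB a a') = tmap id (fun a0 => cmul a0 a') (cc_co a).
Proof. exact: blift_pure can_bal _ _. Qed.

Definition hopf_galois : Prop :=
  exists2 f : hmod_hom (tensB_hmod regB) HA_hmod,
    @is_iso hmodC (tensB_hmod regB) HA_hmod f & forall x, f x = can x.

End HopfModules.

(* Main.v *)
(* For a Hopf module M put P(m) = theta(S(m_(-1))) m_(0). Then P takes values in
   M^coH, is the identity there, satisfies P(am) = P(a)m for m coinvariant, and
   m = theta(m_(-1)) P(m_(0)). Hence m |-> theta(m_(-1)) (x)_B P(m_(0)) inverts the
   counit and a (x)_B n |-> P(a)n inverts the unit. The latter makes N a natural
   retract of A (x)_B N, and a (x)_B n |-> a_(-1) (x) P(a_(0))n makes A (x)_B N a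
   natural retract of H (x)_k N; short exactness passes to retracts, and H (x)_k -
   is exact since short exact sequences of vector spaces split. Finally can is the
   counit of H (x) A composed with the isomorphism A ~ (H (x) A)^coH,
   a |-> 1 (x) a. *)
Require Import Defs.
From mathcomp Require Import all_boot all_order all_algebra.
From mathcomp Require Import boolp classical_sets.

Set Implicit Arguments.
Unset Strict Implicit.
Unset Printing Implicit Defensive.

Import GRing.Theory.
Local Open Scope ring_scope.

(** * Splittings, tensor products and retracts of short exact sequences of vector spaces *)

Section LinearSplitting.
Variable k : fieldType.

(** Zorn's lemma gives a subspace maximal among those meeting f(U) only in 0. It is a complement of
    f(U), and the retraction sends v to the u for which v - f(u) lies in it. *)
Lemma linear_retract (U V : lmodType k) (f : U -> V) : linear f -> injective f ->
  exists2 r : V -> U, linear r & cancel f r.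
Proof.
move=> fl fi.
(* The empty set satisfies [P], so the union of the empty chain is admissible; that the maximal set
   contains 0 is recovered afterwards from maximality. *)
pose P (A : set V) := (forall a u v, A u -> A v -> A (a *: u + v)) /\
  (forall u, A (f u) -> u = 0).
have [|A [[Al Af] Amax]] := @Zorn_bigcup V P.
  move=> F FP Ftot; split=> [a u v [X FX Xu] [Y FY Yv]|u [X FX Xu]]; last first.
    exact: (FP _ FX).2.
  have [XY|YX] := Ftot X Y FX FY.
    by exists Y => //; apply: (FP _ FY).1 => //; apply: XY.
  by exists X => //; apply: (FP _ FX).1 => //; apply: YX.
have A0 : A 0.
  have [[x Ax]|noA] := pselect (exists x, A x).
    by rewrite -(addNr x) -scaleN1r; apply: Al.
  exfalso; apply: (Amax [set 0]%classic).
    split=> [x Ax|sub]; first by case: noA; exists x.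
    by apply: noA; exists 0; apply: sub.
  split=> [a u v -> ->|u fu0]; first by rewrite /= scaler0 addr0.
  by apply: fi; rewrite (lin0 fl).
have AD u v : A u -> A v -> A (u + v) by move=> Au Av; rewrite -[u]scale1r; apply: Al.
have AZ a u : A u -> A (a *: u) by move=> Au; rewrite -[_ *: _]addr0; apply: Al.
have AN u : A u -> A (- u) by rewrite -scaleN1r; apply: AZ.
(* Otherwise A + kv would be strictly larger and still meet f(U) only in 0: if f(u) - cv is in A
   with c nonzero, then v - f(u/c) is in A. *)
have dec v : exists u, A (v - f u).
  apply: contrapT => nv.
  apply: (Amax (fun x => exists c, A (x - c *: v))).
    split=> [x Ax|sub]; first by exists 0; rewrite scale0r subr0.
    apply: nv; exists 0; rewrite (lin0 fl) subr0; apply: sub; exists 1.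
    by rewrite scale1r subrr.
  split=> [a x y [c xc] [d yd]|u [c uc]].
    exists (a * c + d).
    by rewrite scalerDl -scalerA opprD addrACA -scalerBr; apply: Al.
  have [c0|c0] := eqVneq c 0; first by apply: Af; rewrite c0 scale0r subr0 in uc.
  case: nv; exists (c^-1 *: u); rewrite (linZ fl) -opprB; apply: AN.
  rewrite -[v in X in A X](scalerK c0) -scalerBr; exact: AZ.
have [r rP] := choice dec.
have runiq v u : A (v - f u) -> r v = u.
  move=> vu; apply/eqP; rewrite -subr_eq0; apply/eqP/Af.
  rewrite -scaleN1r addrC fl scaleN1r; have := AD _ _ vu (AN _ (rP v)).
  by rewrite opprB addrACA addrC addrA subrK addrC.
exists r => [a u v|u]; apply: runiq; last by rewrite subrr.
by rewrite fl opprD addrACA -scalerBr; apply: Al.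
Qed.

Lemma short_exact_split (U V W : lmodType k) (f : U -> V) (g : V -> W) :
  linear f -> linear g -> short_exact f g ->
  exists r : V -> U, exists s : W -> V,
    [/\ linear r, linear s, cancel f r, cancel s g & forall v, f (r v) + s (g v) = v].
Proof.
move=> fl gl [fi ex gs]; have [r rl rK] := linear_retract fl fi.
have [t tK] := choice gs.
have gf u : g (f u) = 0 by apply/ex; exists u.
have inj0 v : g v = 0 -> r v = 0 -> v = 0.
  by move=> /ex[u <-]; rewrite rK => ->; apply: lin0.
have inj v v' : g v = g v' -> r v = r v' -> v = v'.
  move=> gv rv; apply/eqP; rewrite -subr_eq0; apply/eqP/inj0.
    by rewrite -scaleN1r addrC gl scaleN1r gv addNr.
  by rewrite -scaleN1r addrC rl scaleN1r rv addNr.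
(* Subtracting f(r(t w)) moves the chosen preimage t(w) into the kernel of r. Since v is determined
   by g(v) and r(v), the result is linear in w. *)
pose s w := t w - f (r (t w)).
have sK : cancel s g.
  by move=> w; rewrite /s -scaleN1r addrC gl gf scaler0 add0r tK.
have rs w : r (s w) = 0 by rewrite /s -scaleN1r addrC rl rK scaleN1r addNr.
exists r, s; split=> // [a u v|v].
  by apply: inj; rewrite ?gl ?rl ?sK ?rs ?scaler0 ?addr0.
apply: inj.
  by rewrite (linD gl) gf sK add0r.
by rewrite (linD rl) rK rs addr0.
Qed.

(** The relations rf = id, gs = id, fr + sg = id and gf = 0 are identities between linear maps, so
    they persist after tensoring with T, and exactness follows from them. *)
Lemma short_exact_tmap (T U V W : lmodType k) (f : U -> V) (g : V -> W) :
  linear f -> linear g -> short_exact f g ->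
  short_exact (tmap id f : tens T U -> tens T V) (tmap id g : tens T V -> tens T W).
Proof.
move=> fl gl fg; have [r [s [rl sl rK sK fr]]] := short_exact_split fl gl fg.
case: fg => _ ex _.
have rK' : cancel (tmap id f : tens T U -> _) (tmap id r).
  apply: tens_ext => [||t u]; [by apply: lin_comp; apply: tmap_lin|by []|].
  by rewrite !tmap_pure // rK.
split; first exact: can_inj rK'.
- move=> y; split=> [gy|[x <-]].
    exists (tmap id r y).
    have : tmap id f (tmap id r y) + tmap id s (tmap id g y) = y.
      move: (y) => {gy y}; apply: tens_ext => [||t v].
      + move=> a u v; rewrite !tmap_lin // scalerDr addrACA //.
      + by [].
      by rewrite !tmap_pure // -(linD (pure_linr _)) fr.
    by rewrite gy (lin0 (tmap_lin _ _)) // addr0.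
  move: x; apply: tens_ext => [||t u]; first by apply: lin_comp; apply: tmap_lin.
    by move=> a u v; rewrite scaler0 addr0.
  rewrite !tmap_pure // (_ : g (f u) = 0) ?(lin0 (pure_linr _)) //.
  by apply/ex; exists u.
- move=> z; exists (tmap id s z); move: z.
  apply: tens_ext => [||t w]; [by apply: lin_comp; apply: tmap_lin|by []|].
  by rewrite !tmap_pure // sK.
Qed.

Lemma short_exact_retract (U V W U' V' W' : lmodType k)
    (f : U -> V) (g : V -> W) (f' : U' -> V') (g' : V' -> W')
    (iU : U -> U') (iV : V -> V') (iW : W -> W')
    (rU : U' -> U) (rV : V' -> V) (rW : W' -> W) :
  linear iW -> linear rW ->
  cancel iU rU -> cancel iV rV -> cancel iW rW ->
  (forall u, iV (f u) = f' (iU u)) -> (forall v, iW (g v) = g' (iV v)) ->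
  (forall u, rV (f' u) = f (rU u)) -> (forall v, rW (g' v) = g (rV v)) ->
  short_exact f' g' -> short_exact f g.
Proof.
move=> iWl rWl iUK iVK iWK fi gi fr gr [f'i ex' g's]; split.
- move=> u v fuv; apply: (can_inj iUK); apply: f'i.
  by rewrite -!fi fuv.
- move=> v; split=> [gv|[u <-]].
    have /ex'[u' u'E] : g' (iV v) = 0 by rewrite -gi gv (lin0 iWl).
    by exists (rU u'); rewrite -fr u'E iVK.
  rewrite -[LHS]iWK gi fi (_ : g' _ = 0) ?(lin0 rWl) //.
  by apply/ex'; exists (iU u).
- move=> w; have [v' v'E] := g's (iW w).
  by exists (rV v'); rewrite -gr v'E iWK.
Qed.

End LinearSplitting.

(** * Convolution along a coaction *)

Section Coactions.
Variables (k : fieldType) (G : zmodType) (chi : bicharacter k G) (H : chopf chi).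

Lemma antip_one : antip (cone H) = cone H.
Proof.
have mb : bilin (fun h1 h2 : H => cmul (antip h1) h2).
  have [ml mr] := cmul_bilin H; split=> [h2|h1]; last exact: mr.
  exact: lin_comp (ml h2) (@antip_lin _ _ _ H).
have := antip_l (cone H).
by rewrite Delta_one tlift_pure // cmul1r eps_one scale1r.
Qed.

Lemma counit_bilin (V : lmodType k) : bilin (fun (h : H) (v : V) => eps h *: v).
Proof.
split=> [v|h] a u w; first by rewrite [eps _](@eps_lin _ _ _ H) scalerDl -scalerA.
by rewrite scalerDr !scalerA mulrC.
Qed.

Variable M : gcomod H.

(** In Sweedler notation, m |-> phi(m_(-1), f(m_(0))). The projection onto the coinvariants, the
    decomposition of m and the inverse of the counit all have this form. *)
Definition coact_conv (W W' : lmodType k) (phi : H -> W -> W') (f : M -> W) (m : M) : W' :=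
  tlift (fun h m' => phi h (f m')) (cm_co m).

Lemma comp_bilin (U V W W' : lmodType k) (phi : U -> W -> W') (f : V -> W) :
  bilin phi -> linear f -> bilin (fun u v => phi u (f v)).
Proof.
by move=> [pl pr] fl; split=> [v|u]; [exact: pl|exact: lin_comp (pr u) fl].
Qed.

Lemma coact_conv_lin (W W' : lmodType k) (phi : H -> W -> W') (f : M -> W) :
  bilin phi -> linear f -> linear (coact_conv phi f).
Proof.
move=> pb fl; apply: lin_comp (co_lin (cm_coP M)).
exact/tlift_lin/comp_bilin.
Qed.

Lemma coact_conv_map (W W' X X' : lmodType k) (phi : H -> W -> W') (phi' : H -> X -> X')
    (f : M -> W) (p : W' -> X') (q : W -> X) m :
  bilin phi -> bilin phi' -> linear f -> linear p -> linear q ->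
  (forall h w, p (phi h w) = phi' h (q w)) ->
  p (coact_conv phi f m) = coact_conv phi' (fun m => q (f m)) m.
Proof.
move=> pb pb' fl pl ql pq.
have fb := comp_bilin pb fl; have qb := comp_bilin pb' (lin_comp ql fl).
rewrite /coact_conv; move: (cm_co m); apply: tens_ext => [||h n].
- by apply: lin_comp pl _; apply: tlift_lin.
- exact: tlift_lin.
by rewrite !tlift_pure.
Qed.

(** Coassociativity lets both H-components come from Delta(m_(-1)); the hypothesis then collapses
    them to eps(m_(-1)) f(m_(0)), which is f(m) by the counit axiom. *)
Lemma coact_convK (W W' : lmodType k) (phi : H -> W' -> W) (psi : H -> W -> W') (f : M -> W) :
  bilin phi -> bilin psi ->
  (forall h w, tlift (fun h1 h2 => phi h1 (psi h2 w)) (Delta h) = eps h *: w) ->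
  linear f -> coact_conv phi (coact_conv psi f) =1 f.
Proof.
move=> pb sb inv fl m; have cP := cm_coP M; have cl := co_lin cP.
have sfb := comp_bilin sb fl.
pose r := tlift (fun h m' => psi h (f m')).
have rl : linear r by apply: tlift_lin.
have prb := comp_bilin pb rl.
pose q := tlift (fun h y => phi h (r y)).
have ql : linear q by apply: tlift_lin.
have pcb := comp_bilin pb (lin_comp rl cl).
(* Factoring the double convolution through (id (x) chi_M) chi_M brings it to the shape in which
   coassociativity applies. *)
have -> : coact_conv phi (coact_conv psi f) m = q (tmap id (@cm_co _ _ _ _ M) (cm_co m)).
  rewrite /coact_conv; move: (cm_co m); apply: tens_ext => [||h n].
  - exact: tlift_lin.
  - by apply: lin_comp ql _; apply: tmap_lin.
  by rewrite tlift_pure // tmap_pure // /q tlift_pure.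
rewrite -(co_coassoc cP) -[in RHS](co_counit cP m).
have Dl := @Delta_lin _ _ _ H.
have eb := counit_bilin M.
move: (cm_co m); apply: tens_ext => [||h n].
- by apply: lin_comp ql _; apply: lin_comp; [exact: tassoc_lin|exact: tmap_lin].
- by apply: lin_comp fl _; apply: tlift_lin.
rewrite tmap_pure // tlift_pure // (linZ fl) -inv.
have pfb : bilin (fun h1 h2 => phi h1 (psi h2 (f n))).
  by apply: comp_bilin pb _; apply: (sb.1).
move: (Delta h); apply: tens_ext => [||u v].
- by apply: lin_comp ql _; apply: lin_comp; [exact: tassoc_lin|exact: pure_linl].
- exact: tlift_lin.
by rewrite tassoc_pure /q tlift_pure // /r !tlift_pure.
Qed.

End Coactions.

(** * Twisted actions on H (x) M, and the action of H through theta *)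

Section HopfModuleActions.
Variables (k : fieldType) (G : zmodType) (chi : bicharacter k G).
Variables (H : chopf chi) (A : ccalg H).

(** H (x) M is a module over the colour tensor product algebra H (x) A: on homogeneous pure tensors
    the two scalars agree because the bicharacter is multiplicative in each argument. *)
Lemma ctw_act_assoc (M : hmod A) (x y : tens H A) (z : tens H M) :
  ctw chi (@cmul _ _ H) (@hm_act _ _ _ _ _ M)
    (ctw chi (@cmul _ _ H) (@cmul _ _ A) x y) z =
  ctw chi (@cmul _ _ H) (@hm_act _ _ _ _ _ M) x
    (ctw chi (@cmul _ _ H) (@hm_act _ _ _ _ _ M) y z).
Proof.
have Hb := cmul_bilin H; have Ab := cmul_bilin A.
have P := hm_actP M; have Mb := act_bilin P.
have L t := ctw_linl chi Hb Ab t; have R t := ctw_linr chi Hb Ab t.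
have L' t := ctw_linl chi Hb Mb t; have R' t := ctw_linr chi Hb Mb t.
move: x; apply: htens_ext => [||g1 g2 h1 a1 hh1 ha1].
- exact: lin_comp (L' z) (L y).
- exact: L'.
move: y; apply: htens_ext => [||g3 g4 h2 a2 hh2 ha2].
- exact: lin_comp (L' z) (R _).
- exact: lin_comp (R' _) (L' z).
move: z; apply: htens_ext => [||g5 g6 h3 a3 hh3 ha3].
- exact: R'.
- exact: lin_comp (R' _) (R' _).
rewrite (ctw_pure chi Hb Ab _ _ ha1 hh2) (ctw_pure chi Hb Mb _ _ ha2 hh3).
rewrite (linZ (L' _)) (linZ (R' _)).
rewrite (ctw_pure chi Hb Mb _ _ (cmul_deg ha1 ha2) hh3).
rewrite (ctw_pure chi Hb Mb _ _ ha1 (cmul_deg hh2 hh3)) !scalerA cmulA (actA P).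
by rewrite bichDl bichDr; congr (_ *: _); rewrite mulrA mulrC.
Qed.

Lemma ctw_cone_r (M : hmod A) (x : tens H A) (m : M) :
  ctw chi (@cmul _ _ H) (@hm_act _ _ _ _ _ M) x (cone H ⊗ m) =
  tmap id (fun a => hm_act a m) x.
Proof.
have Hb := cmul_bilin H; have Mb := act_bilin (hm_actP M).
move: x; apply: htens_ext => [||g h p a hp ha].
- exact: ctw_linl.
- by apply: tmap_lin => //; apply: Mb.1.
rewrite (ctw_pure chi Hb Mb _ _ ha (cone_deg H)) bich0r scale1r cmul1r tmap_pure //.
exact: Mb.1.
Qed.

Lemma ctw_cone_l (M : hmod A) (z : tens H M) :
  ctw chi (@cmul _ _ H) (@hm_act _ _ _ _ _ M) (cone H ⊗ cone A) z = z.
Proof.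
have Hb := cmul_bilin H; have P := hm_actP M; have Mb := act_bilin P.
move: z; apply: htens_ext => [||g h p m hp hm].
- exact: ctw_linr.
- by [].
by rewrite (ctw_pure chi Hb Mb _ _ (cone_deg A) hp) bich0l scale1r cmul1l (act1 P).
Qed.

Lemma co_act_coinv (M : hmod A) (a : A) (m : M) : cm_co m = cone H ⊗ m ->
  cm_co (hm_act a m) = tmap id (fun a0 => hm_act a0 m) (cc_co a).
Proof. by move=> mE; rewrite hm_compat mE ctw_cone_r. Qed.

Lemma reg_hmod_actP : is_gmod (@cmul _ _ A).
Proof.
split; [exact: cmul_bilin|by move=> a b c; rewrite cmulA|exact: cmul1l|].
by move=> g h a b; apply: cmul_deg.
Qed.

Definition reg_hmod : hmod A := @HMod _ _ _ _ A (cc_comod A) _ reg_hmod_actP (@cc_mul _ _ _ _ A).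

Variable theta : H -> A.
Hypothesis theta_colinear : @is_gcolinear k G chi H (hopf_comod H) (cc_comod A) theta.
Hypothesis theta_alg : is_calg_hom theta.

Let tl : linear theta := ch_lin theta_alg.

Section Act.
Variables (W : lmodType k) (act : A -> W -> W).
Hypothesis actb : bilin act.
Hypothesis actM : forall a b w, act (cmul a b) w = act a (act b w).
Hypothesis act_one : forall w, act (cone A) w = w.

Lemma theta_act_bilin : bilin (fun h w => act (theta h) w).
Proof.
split=> [w|h]; last exact: actb.2.
exact: lin_comp (actb.1 w) tl.
Qed.

Lemma theta_antip_act_bilin : bilin (fun (h : H) w => act (theta (antip h)) w).
Proof.
split=> [w|h]; last exact: actb.2.
exact: lin_comp (theta_act_bilin.1 w) (@antip_lin _ _ _ H).
Qed.

(** Multiplicativity of theta merges the two successive actions into one, to which an antipode axiom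
    can be applied. Hence theta and theta S act as convolution inverses on any A-module, in
    particular on both M and H (x) M. *)
Let theta_act_lift (p q : H -> H) (h : H) (w : W) : linear p -> linear q ->
  tlift (fun h1 h2 => act (theta (p h1)) (act (theta (q h2)) w)) (Delta h) =
  act (theta (tlift (fun h1 h2 => cmul (p h1) (q h2)) (Delta h))) w.
Proof.
move=> pl ql; have [ml mr] := cmul_bilin H.
have mb : bilin (fun h1 h2 => cmul (p h1) (q h2)).
  split=> [v|u]; first exact: lin_comp (ml (q v)) pl.
  exact: lin_comp (mr (p u)) ql.
have ab : bilin (fun h1 h2 => act (theta (p h1)) (act (theta (q h2)) w)).
  split=> [v|u]; first exact: lin_comp (theta_act_bilin.1 _) pl.
  apply: lin_comp (actb.2 _) _; exact: lin_comp (theta_act_bilin.1 _) ql.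
move: (Delta h); apply: tens_ext => [||u v].
- exact: tlift_lin.
- by apply: lin_comp (theta_act_bilin.1 w) _; apply: tlift_lin.
by rewrite !tlift_pure // (ch_mul theta_alg) actM.
Qed.

Lemma theta_act_antip h w :
  tlift (fun h1 h2 => act (theta h1) (act (theta (antip h2)) w)) (Delta h) = eps h *: w.
Proof.
rewrite (theta_act_lift _ _ (@lin_id _ _) (@antip_lin _ _ _ H)) antip_r.
by rewrite (linZ (theta_act_bilin.1 w)) (ch_one theta_alg) act_one.
Qed.

Lemma theta_antip_act h w :
  tlift (fun h1 h2 => act (theta (antip h1)) (act (theta h2) w)) (Delta h) = eps h *: w.
Proof.
rewrite (theta_act_lift _ _ (@antip_lin _ _ _ H) (@lin_id _ _)) antip_l.
by rewrite (linZ (theta_act_bilin.1 w)) (ch_one theta_alg) act_one.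
Qed.

End Act.

(** * The projection of a Hopf module onto its coinvariants *)

Section Projection.
Variable M : hmod A.

Let P := hm_actP M.
Let actb := act_bilin P.
Let cP := cm_coP M.

Let up (h : H) (m : M) : M := hm_act (theta h) m.
Let down (h : H) (m : M) : M := hm_act (theta (antip h)) m.
Let up_bilin : bilin up := theta_act_bilin actb.
Let down_bilin : bilin down := theta_antip_act_bilin actb.

Definition coinv_proj : M -> M :=
  coact_conv (fun (h : H) (m : M) => hm_act (theta (antip h)) m) id.

Lemma coinv_proj_lin : linear coinv_proj.
Proof. exact: coact_conv_lin down_bilin (@lin_id _ _). Qed.

Lemma coinv_proj_decomp m :
  coact_conv (fun (h : H) (m : M) => hm_act (theta h) m) coinv_proj m = m.
Proof.
apply: coact_convK up_bilin down_bilin _ (@lin_id _ _) m => h w.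
exact: theta_act_antip actb (actA P) (act1 P) h w.
Qed.

(* Convolving with the twisted action of theta h on H (x) M is injective, and it
   sends both m |-> chi_M (P m) and m |-> 1 (x) P m to chi_M. *)
Lemma coinv_proj_coinv m : cm_co (coinv_proj m) = cone H ⊗ coinv_proj m.
Proof.
(* A acts on H (x) M through its coaction. This is a module structure, so convolution with theta can
   be undone by convolution with theta S. *)
pose act2 (a : A) (z : tens H M) :=
  ctw chi (@cmul _ _ H) (@hm_act _ _ _ _ _ M) (cc_co a) z.
have Hb := cmul_bilin H.
have act2b : bilin act2.
  split=> [z|a]; last exact: ctw_linr.
  exact: lin_comp (ctw_linl chi Hb actb z) (co_lin (cc_coP A)).
have act2M a b z : act2 (cmul a b) z = act2 a (act2 b z).
  by rewrite /act2 cc_mul ctw_act_assoc.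
have act21 z : act2 (cone A) z = z by rewrite /act2 cc_one ctw_cone_l.
have ub := theta_act_bilin act2b; have db := theta_antip_act_bilin act2b.
have pl := coinv_proj_lin; have cl := co_lin cP.
pose f1 m := cm_co (coinv_proj m); pose f2 m := cone H ⊗ coinv_proj m.
have f1l : linear f1 by exact: lin_comp cl pl.
have f2l : linear f2 by exact: lin_comp (pure_linr _) pl.
have K := coact_convK db ub (theta_antip_act act2b act2M act21).
suff E n : coact_conv (fun h z => act2 (theta h) z) f1 n =
           coact_conv (fun h z => act2 (theta h) z) f2 n.
  rewrite -[LHS](K _ f1 f1l) -[RHS](K _ f2 f2l); congr (coact_conv _ _ m).
  exact/funext.
transitivity (cm_co n).
  (* For [f1]: chi_M is A-linear for [act2], so it may be applied to n = theta(n_(-1)) P(n_(0))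
     under the convolution. *)
  rewrite -[in RHS](coinv_proj_decomp n); symmetry.
  apply: (coact_conv_map (q := @cm_co _ _ _ _ M)) => // h w.
  by rewrite hm_compat.
pose u := tlift (fun (h : H) (m : M) => hm_act (theta h) (coinv_proj m)).
have upb := comp_bilin up_bilin pl.
have ul : linear u by apply: tlift_lin.
(* For [f2]: colinearity of theta gives chi_A(theta(h)) = h_1 (x) theta(h_2), and acting on 1 (x)
   P(m') leaves h_1 (x) theta(h_2) P(m'). *)
have -> : coact_conv (fun h z => act2 (theta h) z) f2 n =
    tmap id u (tassoc (tmap (@Delta _ _ _ H) id (cm_co n))).
  have Dl := @Delta_lin _ _ _ H.
  have bb := comp_bilin ub f2l.
  rewrite /coact_conv; move: (cm_co n); apply: tens_ext => [||h m'].
  - exact: tlift_lin.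
  - apply: lin_comp; first exact: tmap_lin.
    by apply: lin_comp; [exact: tassoc_lin|exact: tmap_lin].
  rewrite tlift_pure // tmap_pure // /act2 /f2 ctw_cone_r.
  rewrite [cc_co _](gcl_co theta_colinear) /=.
  move: (Delta h); apply: tens_ext => [||h1 h2].
  - apply: lin_comp; apply: tmap_lin => //; exact: actb.1.
  - apply: lin_comp; first exact: tmap_lin.
    by apply: lin_comp; [exact: tassoc_lin|exact: pure_linl].
  rewrite tassoc_pure !tmap_pure //; last exact: actb.1.
  by rewrite /u tlift_pure.
(* By coassociativity [u] is now applied to chi_M(n_(0)), and u chi_M is the identity by the
   decomposition formula. *)
rewrite (co_coassoc cP) tmap_comp // -[LHS]tmap_id; congr (tmap _ _ _).
by apply/funext => m' /=; rewrite -[LHS](coinv_proj_decomp m').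
Qed.

Definition to_coinv (m : M) : coinv_mod M :=
  @Coinv _ _ _ _ M (coinv_proj m) (introT (is_coinvP _) (coinv_proj_coinv m)).

Lemma to_coinv_lin : linear to_coinv.
Proof. move=> a u v; apply: coinv_val_inj; exact: coinv_proj_lin. Qed.

Lemma coinv_proj_id m : cm_co m = cone H ⊗ m -> coinv_proj m = m.
Proof.
move=> mE; rewrite /coinv_proj /coact_conv mE tlift_pure; last exact: down_bilin.
by rewrite antip_one (ch_one theta_alg) (act1 P).
Qed.

End Projection.

(** For coinvariant m the coaction sends am to a_(-1) (x) a_(0) m, so only the coaction of A is left
    in the convolution. *)
Lemma coact_conv_act_coinv (M : hmod A) (W W' : lmodType k) (phi : H -> W -> W')
    (f : M -> W) (a : A) (m : M) :
  bilin phi -> linear f -> cm_co m = cone H ⊗ m ->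
  coact_conv phi f (hm_act a m) =
  @coact_conv _ _ _ _ reg_hmod _ _ phi (fun a0 : A => f (hm_act a0 m)) a.
Proof.
move=> pb fl mE; have aml := (act_bilin (hm_actP M)).1 m.
rewrite /coact_conv co_act_coinv //=.
have b1 := comp_bilin pb fl; have b2 := comp_bilin pb (lin_comp fl aml).
move: (cc_co a); apply: tens_ext => [||h b].
- by apply: lin_comp; [exact: tlift_lin|exact: tmap_lin].
- exact: tlift_lin.
by rewrite tmap_pure // !tlift_pure.
Qed.

Lemma coinv_proj_act (M : hmod A) (a : A) (m : M) : cm_co m = cone H ⊗ m ->
  coinv_proj (hm_act a m) = hm_act (@coinv_proj reg_hmod a) m.
Proof.
move=> mE; have P := hm_actP M; have aml := (act_bilin P).1 m.
rewrite [LHS]coact_conv_act_coinv //; last exact: theta_antip_act_bilin (act_bilin P).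
symmetry.
apply: (@coact_conv_map _ _ _ _ reg_hmod reg_hmod reg_hmod M M _ _ id
  (fun a0 : A => hm_act a0 m) (fun a0 : A => hm_act a0 m)) => //.
- exact: (theta_antip_act_bilin (act_bilin (hm_actP reg_hmod))).
- exact: theta_antip_act_bilin (act_bilin P).
- by move=> h w; rewrite (actA P).
Qed.
End HopfModuleActions.

(** * Bijective morphisms of graded modules and of Hopf modules are isomorphisms *)

Section InverseMaps.
Variables (k : fieldType) (G : zmodType).

Lemma inverse_lin (U V : lmodType k) (f : U -> V) (g : V -> U) :
  linear f -> cancel f g -> cancel g f -> linear g.
Proof. by move=> fl fK gK a u v; apply: (can_inj fK); rewrite fl !gK. Qed.

Lemma inverse_graded (U V : gvect k G) (f : U -> V) (g : V -> U) :
  linear f -> graded f -> cancel f g -> cancel g f -> graded g.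
Proof.
move=> fl fg fK gK d v hv; apply: (can_inj fK).
(* Shift 0 in [degP]: being graded means commuting with homogeneous components, an equation that
   passes to the inverse. *)
have /(@degP _ _ _ _ _ 0 fl) fd : forall h u, homog h u -> homog (h + 0) (f u).
  by move=> h u hu; rewrite addr0; apply: fg.
by rewrite -[LHS]fd addr0 gK.
Qed.

Lemma bij_gmod_iso (R : calg k G) (M N : gmod R) (f : gmod_hom M N) (g : N -> M) :
  cancel f g -> cancel g f -> @is_iso (gmodC R) M N f.
Proof.
move=> fK gK; have [fl fg fa] := gmh_homP f.
have gP : is_gmod_hom g.
  split; [exact: inverse_lin fl fK gK|exact: inverse_graded fl fg fK gK|].
  by move=> b n; apply: (can_inj fK); rewrite fa !gK.
by exists (GModHom gP); split; apply: gmod_hom_eq.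
Qed.

Lemma bij_hmod_iso (chi : bicharacter k G) (H : chopf chi) (A : ccalg H) (M N : hmod A)
    (f : hmod_hom M N) (g : N -> M) :
  cancel f g -> cancel g f -> @is_iso (hmodC A) M N f.
Proof.
move=> fK gK; have [[fl fg fc] fa] := hmh_homP f.
have gl := inverse_lin fl fK gK.
have gP : is_hmod_hom g.
  split; first split=> //; first exact: inverse_graded fl fg fK gK.
    move=> n; rewrite -[in RHS](gK n) fc tmap_comp // -[LHS]tmap_id.
    by congr (tmap _ _ _); apply/funext => m /=; rewrite fK.
  by move=> a n; apply: (can_inj fK); rewrite fa !gK.
by exists (HModHom gP); split; apply: hmod_hom_eq.
Qed.

End InverseMaps.

Lemma is_iso_cmp (C : category) (X Y Z : C) (g : mor Y Z) (f : mor X Y) :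
  is_iso g -> is_iso f -> is_iso (cmp g f).
Proof.
move=> [g' [gK Kg]] [f' [fK Kf]]; exists (cmp f' g'); split.
  by rewrite -cmpA (cmpA g') gK cmp1m fK.
by rewrite -cmpA (cmpA f) Kf cmp1m Kg.
Qed.

Lemma is_iso_fmor (C D : category) (L : functor C D) (X Y : C) (f : mor X Y) :
  is_iso f -> is_iso (fmor L f).
Proof. by move=> [g [gf fg]]; exists (fmor L g); rewrite -!fmor_cmp gf fg !fmor_id. Qed.

(** * Invertibility of the unit and the counit *)

Section Equivalence.
Variables (k : fieldType) (G : zmodType) (chi : bicharacter k G).
Variables (H : chopf chi) (A : ccalg H) (theta : H -> A).
Hypothesis theta_colinear : @is_gcolinear k G chi H (hopf_comod H) (cc_comod A) theta.
Hypothesis theta_alg : is_calg_hom theta.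

Let B := coinv_alg A.
Let tl : linear theta := ch_lin theta_alg.
Let P_coinv := coinv_proj_coinv theta_colinear theta_alg.
Let P_id := coinv_proj_id theta_alg.
Let P_act := coinv_proj_act theta_alg.
Let toB (a : A) : B := to_coinv theta_colinear theta_alg (a : reg_hmod A).

Section Eta.
Variable N : gmod B.

(** Defined on all of A (x)_B N and not just on its coinvariants: this is what makes N a natural
    retract of A (x)_B N. *)
Definition eta_inv : tensB_hmod N -> N := blift (fun (a : A) (n : N) => gm_act (toB a) n).

Lemma eta_inv_bal :
  balanced (@raB _ _ _ _ A) (@laB _ _ _ _ _ N) (fun (a : A) (n : N) => gm_act (toB a) n).
Proof.
have Nb := act_bilin (gm_actP N); split; first split=> [n|a].
- exact: lin_comp (Nb.1 n) (to_coinv_lin _ _ (M := reg_hmod A)).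
- exact: Nb.2.
move=> a b n; rewrite /laB -(actA (gm_actP N)); congr gm_act.
by apply: coinv_val_inj; apply: (P_act (M := reg_hmod A)) => //; apply: coinvE.
Qed.

Lemma eta_invE a n : eta_inv (pureB a n) = gm_act (toB a) n.
Proof. exact: blift_pure eta_inv_bal _ _. Qed.

Lemma eta_inv_lin : linear eta_inv.
Proof. exact: blift_lin eta_inv_bal. Qed.

Lemma toB_one : toB (cone A) = cone B.
Proof. by apply: coinv_val_inj; apply: (P_id (M := reg_hmod A)); apply: cc_one. Qed.

Lemma etaK : cancel (@eta _ _ _ _ _ N) (fun x => eta_inv (coinv_val x)).
Proof. by move=> n; rewrite eta_invE toB_one (act1 (gm_actP N)). Qed.

(** Write a (x) n as a(1 (x) n) with 1 (x) n coinvariant. Then P gives P(a) (x) n, and P(a), lying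
    in B, moves across the tensor sign. *)
Lemma coinv_proj_tensB (x : tensB_hmod N) :
  coinv_proj theta x = pureB (cone A) (eta_inv x).
Proof.
move: x; apply: tensB_ext => [||a n].
- exact: (coinv_proj_lin theta_alg (M := tensB_hmod N)).
- exact: lin_comp (pureB_linr _) eta_inv_lin.
have -> : pureB a n = tensB_act a (pureB (cone A) n) by rewrite tensB_actE cmul1r.
rewrite [LHS](P_act (M := tensB_hmod N)); last exact/is_coinvP/eta_subproof.
rewrite [LHS]tensB_actE cmul1r tensB_actE cmul1r eta_invE -pureB_bal.
by rewrite cmul1l.
Qed.

Lemma eta_invK : cancel (fun x => eta_inv (coinv_val x)) (@eta _ _ _ _ _ N).
Proof.
move=> x; apply: coinv_val_inj; rewrite /= -coinv_proj_tensB P_id //.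
exact: coinvE.
Qed.

End Eta.

Section Alpha.
Variable M : hmod A.
Let actb := act_bilin (hm_actP M).
Let to : M -> coinv_mod M := to_coinv theta_colinear theta_alg (M := M).
Let tol : linear to. Proof. exact: to_coinv_lin. Qed.

Lemma theta_pureB_bilin (N : gmod B) : bilin (fun (h : H) (n : N) => pureB (theta h) n).
Proof.
split=> [n|h]; last exact: pureB_linr.
exact: lin_comp (pureB_linl n) tl.
Qed.

Definition alpha_inv : M -> tensB_hmod (coinv_mod M) :=
  coact_conv (fun h m => pureB (theta h) m) to.

Lemma alpha_invK : cancel alpha_inv (@alpha _ _ _ _ _ M).
Proof.
move=> m; rewrite -[RHS](coinv_proj_decomp theta_alg).
apply: (coact_conv_map (q := @coinv_val _ _ _ _ M)) => //.
- exact: theta_pureB_bilin (coinv_mod M).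
- exact: (theta_act_bilin theta_alg actb).
- exact: alpha_lin.
- by move=> h w; rewrite alphaE.
Qed.

Lemma alphaK : cancel (@alpha _ _ _ _ _ M) alpha_inv.
Proof.
apply: tensB_ext => [||a m]; [|by []|].
  apply: lin_comp (alpha_lin (M := M)).
  by apply: coact_conv_lin => //; apply: theta_pureB_bilin.
(* The computation is theta(a_(-1)) (x) P(a_(0) m) = theta(a_(-1)) (x) P(a_(0)) m = theta(a_(-1))
   P(a_(0)) (x) m = a (x) m, the middle step using that P(a_(0)) is in B. *)
rewrite alphaE /alpha_inv coact_conv_act_coinv //;
  [|exact: theta_pureB_bilin|exact: coinvE].
rewrite -[in RHS](coinv_proj_decomp theta_alg (M := reg_hmod A) a).
symmetry; apply: etrans.
  apply: (coact_conv_map (p := fun a0 : reg_hmod A => pureB a0 m)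
    (q := fun b : reg_hmod A => b)
    (phi' := fun h (b : reg_hmod A) => pureB (cmul (theta h) b) m)) => //.
  - exact: (theta_act_bilin theta_alg (act_bilin (hm_actP (reg_hmod A)))).
  - split=> [b|h].
      exact: lin_comp (pureB_linl m) (lin_comp ((cmul_bilin A).1 b) tl).
    exact: lin_comp (pureB_linl m) ((cmul_bilin A).2 (theta h)).
  - exact: (coinv_proj_lin theta_alg).
  - exact: pureB_linl.
congr tlift; apply/funext => h; apply/funext => a0.
rewrite -[coinv_proj _ _]/(coinv_val (toB a0)) pureB_bal; congr pureB.
by apply: coinv_val_inj => /=; rewrite P_act //; apply: coinvE.
Qed.
End Alpha.

Lemma tensB_coinv_equiv : inverse_equivalences (tensB_coinv_adj A).
Proof.
split=> [N|M].
  exact: (@bij_gmod_iso _ _ B _ _ (GModHom (eta_homP N)) _ (@etaK N) (@eta_invK N)).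
exact: (@bij_hmod_iso _ _ _ _ _ _ _ (HModHom (alpha_homP M)) _ (@alphaK M) (@alpha_invK M)).
Qed.

(** * Faithful flatness by retracts *)

Section Flat.

Let emb (N : gmod B) (x : tensB_hmod N) : tens H N :=
  tmap id (@eta_inv N) (tensB_co x).
Let ret (N : gmod B) : tens H N -> tensB_hmod N :=
  tlift (fun (h : H) (n : N) => pureB (theta h) n).

Let emb_lin N : linear (@emb N).
Proof.
apply: lin_comp (@tensB_co_lin _ _ _ _ _ _); apply: tmap_lin => //; exact: eta_inv_lin.
Qed.

Let ret_lin N : linear (@ret N).
Proof. exact/tlift_lin/theta_pureB_bilin. Qed.

(** The composite sends x to theta(x_(-1)) (x) [eta_inv](x_(0)) = theta(x_(-1)) (1 (x)
    [eta_inv](x_(0))). By [coinv_proj_tensB] this is theta(x_(-1)) P(x_(0)) = x. *)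
Let embK N : cancel (@emb N) (@ret N).
Proof.
move=> x; rewrite -[RHS](coinv_proj_decomp theta_alg) /coact_conv /emb.
have il := @eta_inv_lin N; have tb := theta_pureB_bilin N.
have cb : bilin (fun (h : H) (y : tensB_hmod N) => hm_act (theta h) (coinv_proj theta y)).
  exact: (comp_bilin (theta_act_bilin theta_alg (act_bilin (hm_actP (tensB_hmod N))))
    (coinv_proj_lin theta_alg (M := tensB_hmod N))).
rewrite /=; move: (tensB_co x); apply: tens_ext => [||h y].
- apply: lin_comp; [exact: ret_lin|exact: tmap_lin].
- exact: tlift_lin.
rewrite tmap_pure // /ret !tlift_pure // coinv_proj_tensB.
by rewrite [RHS]tensB_actE cmul1r.
Qed.

Let ret_nat (N N' : gmod B) (f : gmod_hom N N') z :
  ret (tmap id f z) = tensB_map f (ret z).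
Proof.
have fl := gmh_lin (gmh_homP f); have tb := theta_pureB_bilin.
move: z; apply: tens_ext => [||h n].
- apply: lin_comp; [exact: ret_lin|exact: tmap_lin].
- apply: lin_comp; [exact: tensB_map_lin|exact: ret_lin].
by rewrite tmap_pure // /ret !tlift_pure // tensB_mapE.
Qed.

Lemma eta_inv_nat (N N' : gmod B) (f : gmod_hom N N') x :
  eta_inv (tensB_map f x) = f (eta_inv x).
Proof.
have [fl _ fa] := gmh_homP f; move: x; apply: tensB_ext => [||a n].
- apply: lin_comp; [exact: eta_inv_lin|exact: tensB_map_lin].
- by apply: lin_comp fl _; exact: eta_inv_lin.
by rewrite tensB_mapE !eta_invE fa.
Qed.

Let emb_nat (N N' : gmod B) (f : gmod_hom N N') x :
  emb (tensB_map f x) = tmap id f (emb x).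
Proof.
have [[ml _ mc] _] := tensB_map_homP f; have fl := gmh_lin (gmh_homP f).
have il := eta_inv_lin.
rewrite /emb [tensB_co _]mc !tmap_comp //; congr (tmap _ _ _).
by apply/funext => y /=; rewrite eta_inv_nat.
Qed.

Lemma tensB_faithfully_flat : faithfully_flat A.
Proof.
move=> N N' N'' f g; have fl := gmh_lin (gmh_homP f); have gl := gmh_lin (gmh_homP g).
split=> [|FG].
  move=> /(short_exact_tmap H fl gl).
  apply: (short_exact_retract (@emb_lin N'') (@ret_lin N'') (@embK N) (@embK N') (@embK N'')).
  - exact: emb_nat.
  - exact: emb_nat.
  - exact: ret_nat.
  - exact: ret_nat.
(* Conversely, n |-> 1 (x) n and [eta_inv] exhibit the original sequence as a retract of the
   tensored one. *)
have un (X : gmod B) : cancel (pureB (cone A)) (@eta_inv X) by move=> x; apply: etaK.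
apply: (short_exact_retract _ (@eta_inv_lin N'') (un N) (un N') (un N'')) FG.
- exact: pureB_linr.
- by move=> n; rewrite tensB_mapE.
- by move=> n; rewrite tensB_mapE.
- exact: eta_inv_nat.
- exact: eta_inv_nat.
Qed.

End Flat.
End Equivalence.

(** * The coinvariants of H (x) A and the Galois map *)

Section Galois.
Variables (k : fieldType) (G : zmodType) (chi : bicharacter k G).
Variables (H : chopf chi) (A : ccalg H).

Lemma HA_unit_coinv (a : A) : (cone H ⊗ a : HA_comod A) \in @is_coinv _ _ _ _ (HA_hmod A).
Proof. by apply/is_coinvP; rewrite [LHS]HA_coE Delta_one psi_pure. Qed.

Definition HA_unit (a : regB A) : coinv_mod (HA_hmod A) := Coinv (HA_unit_coinv a).

Lemma HA_unit_homP : is_gmod_hom HA_unit.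
Proof.
split.
- by move=> c a a'; apply: coinv_val_inj; apply: pure_linr.
- move=> g a ha; apply/homog_coinv; rewrite -[g]add0r; apply: homog_pure => //.
  exact: cone_deg.
- move=> b a; apply: coinv_val_inj; rewrite /= /HA_act.
  rewrite -[cc_co _]/(@cm_co _ _ _ _ (cc_comod A) _) coinvE.
  symmetry; exact: ctw_coinv (cmul_bilin A).
Qed.

Definition HA_counit (z : coinv_mod (HA_hmod A)) : regB A :=
  tlift (fun (h : H) (a : A) => eps h *: a) (coinv_val z).

Lemma HA_unitK : cancel HA_unit HA_counit.
Proof.
move=> a; rewrite /HA_counit /= tlift_pure ?eps_one ?scale1r //.
exact: counit_bilin.
Qed.

Lemma HA_counitK : cancel HA_counit HA_unit.
Proof.
move=> z; apply: coinv_val_inj; rewrite /= /HA_counit.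
(* Apply id (x) (eps (x) id) to the coinvariance equation of z: the coaction side returns z by the
   right counit axiom, the other side is 1 (x) (eps (x) id)(z). *)
have /(congr1 (tmap id (tlift (fun (h : H) (a : A) => eps h *: a)))) := coinvE z.
have eb := counit_bilin H A; have el := tlift_lin eb.
rewrite tmap_pure // => <- /=; rewrite /HA_co.
have Dl := @Delta_lin _ _ _ H.
move: (coinv_val z); apply: tens_ext => [||h a].
- apply: lin_comp; first exact: tmap_lin.
  by apply: lin_comp; [exact: tassoc_lin|exact: tmap_lin].
- by [].
rewrite tmap_pure // -[in RHS](Delta_counitr h).
have eb' : bilin (fun h1 h2 : H => eps h2 *: h1).
  by have [x y] := counit_bilin H H; split.
move: (Delta h); apply: tens_ext => [||u v].
- apply: lin_comp; first exact: tmap_lin.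
  by apply: lin_comp; [exact: tassoc_lin|exact: pure_linl].
- by apply: lin_comp (pure_linl a) _; apply: tlift_lin.
rewrite tassoc_pure tmap_pure // !tlift_pure //.
by rewrite (linZ (pure_linl _)) (linZ (pure_linr _)).
Qed.

Lemma equiv_hopf_galois : inverse_equivalences (tensB_coinv_adj A) -> hopf_galois A.
Proof.
move=> [_ alpha_iso].
exists (@cmp (hmodC A) (tensB_hmod (regB A)) _ (HA_hmod A)
  (HModHom (alpha_homP (HA_hmod A))) (fmor (tensBF A) (GModHom HA_unit_homP))).
  apply: is_iso_cmp; first exact: alpha_iso.
  apply: (@is_iso_fmor _ _ (tensBF A) _ (coinv_mod (HA_hmod A))).
  exact: (@bij_gmod_iso _ _ _ _ _ (GModHom HA_unit_homP) _ HA_unitK HA_counitK).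
apply: tensB_ext => [||a a'] /=.
- exact: (lin_comp (alpha_lin (M := HA_hmod A)) (tensB_map_lin (GModHom HA_unit_homP))).
- exact: blift_lin (can_bal A).
(* The composite sends a (x) a' to a(1 (x) a'), which is a_(-1) (x) a_(0) a' because the twist by
   the degree of 1 is trivial. *)
rewrite canE tensB_mapE alphaE /= /HA_act.
exact: (@ctw_cone_r _ _ _ _ _ (reg_hmod A)).
Qed.

End Galois.

Theorem theorem3p19 (k : fieldType) (G : zmodType) (chi : bicharacter k G)
    (H : chopf chi) (A : ccalg H) (theta : H -> A)
    (theta_colinear : @is_gcolinear k G chi H (hopf_comod H) (cc_comod A) theta)
    (theta_alg : is_calg_hom theta) :
  inverse_equivalences (tensB_coinv_adj A) /\
  faithfully_flat A /\
  hopf_galois A.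
Proof.
have equiv := tensB_coinv_equiv theta_colinear theta_alg.
split=> //; split; last exact: equiv_hopf_galois.
exact: tensB_faithfully_flat theta_colinear theta_alg.
Qed.
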